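(* Consider the D-SG iterates $x^{(k+1)}=\mathcal{W}x^{(k)}-\alpha\tilde\nabla F(x^{(k)})$ with constant stepsize $\alpha\in\left(0,\frac{1+\lambda_N^W}{\mu+L}\right)$. Then, for every $k\ge 0$, $$\mathbb{E}\left[\|x^{(k)}-x^\infty\|^2\right]\le(1-\alpha\mu)^{2k}\|x^{(0)}-x^\infty\|^2+\alpha\sigma^2N\,\frac{1-(1-\alpha\mu)^{2k}}{\mu(2-\alpha\mu)},$$ which implies that $J_\infty(\alpha):=\frac{1}{\sigma^2N}\limsup_{k\to\infty}\mathrm{Var}(x^{(k)})$ satisfies $$J_\infty(\alpha)\le\frac{\alpha}{\mu(2-\alpha\mu)}.$$ In addition, if $\alpha\le\frac{1}{L+\mu}$, then for every $k\ge 0$, $$\mathbb{E}\left[\|x^{(k)}-x^*\|^2\right]\le 2(1-\alpha\mu)^{2k}\|x^{(0)}-x^\infty\|^2+2\alpha\sigma^2N\,\frac{1-(1-\alpha\mu)^{2k}}{\mu(2-\alpha\mu)}+\frac{2\alpha^2C_1^2N}{(1-\gamma)^2}.$$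
   Context: Functions: $f_1,\dots,f_N:\mathbb{R}^d\to\mathbb{R}$ are each $\mu$-strongly convex with $L$-Lipschitz gradient ($0<\mu\le L$). $F:\mathbb{R}^{Nd}\to\mathbb{R}$, $F(x_1,\dots,x_N)=\sum_{i=1}^N f_i(x_i)$. $x_*\in\mathbb{R}^d$ is the unique minimizer of $f=\frac1N\sum_{i=1}^N f_i$ and $x^*=[x_*^T,\dots,x_*^T]^T\in\mathbb{R}^{Nd}$. Network: $(\mathcal V,\mathcal E)$ is a connected undirected graph on $\{1,\dots,N\}$; $W$ is a symmetric doubly stochastic $N\times N$ matrix with, for $i\ne j$, $W_{ij}>0$ if $(i,j)\in\mathcal E$ and $W_{ij}=0$ otherwise, and $W_{ii}=1-\sum_{j\neq i}W_{ij}>0$. Its eigenvalues are $1=\lambda_1^W>\lambda_2^W\ge\cdots\ge\lambda_N^W>-1$; $\gamma:=\max\{|\lambda_2^W|,|\lambda_N^W|\}$; $\mathcal{W}:=W\otimes I_d$. Iterates: $x^{(k)}=[(x_1^{(k)})^T,\dots,(x_N^{(k)})^T]^T\in\mathbb{R}^{Nd}$, with deterministic $x^{(0)}$; $\tilde\nabla F(x^{(k)})$ stacks the stochastic gradients $\tilde\nabla f_i(x_i^{(k)})=\tilde\nabla f_i(x_i^{(k)},w_i^{(k)})$. Noise: $w_i^{(k)}$ is a random variable independent of all $w_j^{(t)}$ with $t<k$ and of $w_j^{(k)}$, $j\neq i$, and $\mathbb{E}[\tilde\nabla f_i(x_i^{(k)},w_i^{(k)})\,|\,x_i^{(k)}]=\nabla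 f_i(x_i^{(k)})$, $\mathbb{E}[\|\tilde\nabla f_i(x_i^{(k)},w_i^{(k)})-\nabla f_i(x_i^{(k)})\|^2\,|\,x_i^{(k)}]\le\sigma^2$, with $\sigma>0$ where $J_\infty$ is considered. Fixed point: $x^\infty\in\mathbb{R}^{Nd}$ is the unique solution of $(I_{Nd}-\mathcal W)x^\infty+\alpha\nabla F(x^\infty)=0$. Constant: $C_1:=\sqrt{2L\sum_{i=1}^N(f_i(0)-f_i^* )}\cdot\left(1+\frac{2(L+\mu)}{\mu}\right)$ with $f_i^*:=\min_{x\in\mathbb{R}^d}f_i(x)$. For a random vector $X$, $\mathrm{Var}(X)=\mathbb{E}\|X-\mathbb{E}X\|^2$. *)

(* Defs.v *)
From HB Require Import structures.
From mathcomp Require Import all_boot all_order all_algebra.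
From mathcomp Require Import all_classical all_reals all_analysis.
From mathcomp.real_closed Require Import mxtens.

Set Implicit Arguments.
Unset Strict Implicit.
Unset Printing Implicit Defensive.

Import Order.TTheory GRing.Theory Num.Theory.
Import numFieldNormedType.Exports.

Local Open Scope classical_set_scope.
Local Open Scope ring_scope.

(* The library norm `|x| on matrices is the sup norm, hence this one. *)
Definition enorm (R : realType) (n : nat) (x : 'cV[R]_n) : R :=
  Num.sqrt (\sum_(i < n) x i 0 ^+ 2).

Definition grad (R : realType) (n : nat) (f : 'cV[R]_n -> R) (x : 'cV[R]_n) :
    'cV[R]_n :=
  \col_(j < n) 'D_(delta_mx j 0) f x.

Definition strongly_convex (R : realType) (n : nat) (mu : R)
    (f : 'cV[R]_n -> R) : Prop :=
  forall (x y : 'cV[R]_n) (t : R), 0 <= t <= 1 ->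
    f (t *: x + (1 - t) *: y) <=
      t * f x + (1 - t) * f y - mu / 2 * (t * (1 - t)) * enorm (x - y) ^+ 2.

Definition lipschitz_gradient (R : realType) (n : nat) (L : R)
    (f : 'cV[R]_n -> R) : Prop :=
  (forall x, differentiable f x) /\
  (forall x y, enorm (grad f x - grad f y) <= L * enorm (x - y)).

Definition average (R : realType) (N n : nat) (f : 'I_N -> 'cV[R]_n -> R)
    (x : 'cV[R]_n) : R :=
  N%:R^-1 * \sum_(i < N) f i x.

(* A vector of R^(Nd) is a column whose entry mxtens_index (i, j) = i * d + j
   is the j-th coordinate of its i-th block; this is also the indexing of the
   Kronecker product W *t 1%:M. *)
Definition block (R : realType) (N d : nat) (i : 'I_N) (x : 'cV[R]_(N * d)) :
    'cV[R]_d :=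
  \col_(j < d) x (mxtens_index (i, j)) 0.

Definition stack (R : realType) (N d : nat) (u : 'I_N -> 'cV[R]_d) :
    'cV[R]_(N * d) :=
  \col_k u (mxtens_unindex k).1 (mxtens_unindex k).2 0.

Definition sum_blocks (R : realType) (N d : nat) (f : 'I_N -> 'cV[R]_d -> R)
    (x : 'cV[R]_(N * d)) : R :=
  \sum_(i < N) f i (block i x).

Definition kron_id (R : realType) (N d : nat) (W : 'M[R]_N) : 'M[R]_(N * d) :=
  W *t (1%:M : 'M[R]_d).

Definition connected_graph (N : nat) (e : rel 'I_N) : Prop :=
  symmetric e /\ (forall i j, connect e i j).

Definition mixing_matrix (R : realType) (N : nat) (e : rel 'I_N)
    (W : 'M[R]_N) : Prop :=
  [/\ W^T = W,
      (forall i j, 0 <= W i j) /\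
        (forall i, \sum_(j < N) W i j = 1) /\
        (forall j, \sum_(i < N) W i j = 1),
      (forall i j, i != j ->
         (e i j -> 0 < W i j) /\ (~~ e i j -> W i j = 0))
    & (forall i, W i i = 1 - \sum_(j < N | j != i) W i j /\ 0 < W i i)].

(* All eigenvalues with multiplicity; lam`_i is lambda_(i+1). *)
Definition ordered_eigenvalues (R : realType) (N : nat) (W : 'M[R]_N)
    (lam : N.-tuple R) : Prop :=
  sorted >=%O lam /\ char_poly W = \prod_(l <- lam) ('X - l%:P).

Definition gamma_of (R : realType) (N : nat) (lam : N.-tuple R) : R :=
  Num.max `|lam`_1| `|lam`_(N.-1)|.

(* The infimum is attained, by strong convexity. *)
Definition min_value (R : realType) (n : nat) (f : 'cV[R]_n -> R) : R :=
  inf (range f).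

Definition C1_of (R : realType) (N d : nat) (mu L : R)
    (f : 'I_N -> 'cV[R]_d -> R) : R :=
  Num.sqrt (2 * L * \sum_(i < N) (f i 0 - min_value (f i))) *
    (1 + 2 * (L + mu) / mu).

(* R^n with the sigma-algebra generated by the coordinates, i.e. its Borel
   sigma-algebra. *)
Definition borelcV (R : realType) (n : nat) :=
  g_sigma_algebraType (\bigcup_(i in [set: 'I_n])
    preimage_set_system setT (fun x : 'cV[R]_n => x i 0) measurable).

Definition sigma_of (dU : measure_display) (T : Type) (U : measurableType dU)
    (X : T -> U) : set_system T :=
  preimage_set_system setT X measurable.

Definition independent_sigma (d : measure_display) (T : measurableType d)
    (R : realType) (P : probability T R) (G H : set_system T) : Prop :=
  forall A B, G A -> H B -> P (A `&` B) = (P A * P B)%E.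

(* Z is a version of the conditional expectation of Y given the
   sub-sigma-algebra G. *)
Definition is_condexp (d : measure_display) (T : measurableType d)
    (R : realType) (P : probability T R) (G : set_system T) (Y Z : T -> R) :
    Prop :=
  [/\ P.-integrable setT (EFin \o Y),
      P.-integrable setT (EFin \o Z),
      (forall B, measurable B -> G (Z @^-1` B))
    & (forall A, G A ->
        (\int[P]_(t in A) (Y t)%:E = \int[P]_(t in A) (Z t)%:E)%E)].

Definition vmean (d : measure_display) (T : measurableType d) (R : realType)
    (P : probability T R) (n : nat) (X : T -> 'cV[R]_n) : 'cV[R]_n :=
  \col_(i < n) fine 'E_P[(fun t => X t i 0)%R]%E.

Definition vvar (d : measure_display) (T : measurableType d) (R : realType)
    (P : probability T R) (n : nat) (X : T -> 'cV[R]_n) : \bar R :=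
  'E_P[(fun t => enorm (X t - vmean P X) ^+ 2)%R]%E.

Definition J_infty (d : measure_display) (T : measurableType d) (R : realType)
    (P : probability T R) (N n : nat) (sigma : R)
    (x : nat -> T -> 'cV[R]_n) : \bar R :=
  (((sigma ^+ 2 * N%:R)^-1)%:E * limn_esup (fun k => vvar P (x k)))%E.

(* g i z v is the stochastic gradient of the i-th function at z with noise
   value v, and w k i the noise of agent i at step k. *)
Fixpoint dsg (T E : Type) (R : realType) (N d : nat) (W : 'M[R]_N) (alpha : R)
    (g : 'I_N -> 'cV[R]_d -> E -> 'cV[R]_d) (w : nat -> 'I_N -> T -> E)
    (x0 : 'cV[R]_(N * d)) (k : nat) (t : T) : 'cV[R]_(N * d) :=
  if k is k'.+1 then
    let x := dsg W alpha g w x0 k' t in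
    kron_id d W *m x - alpha *: stack (fun i => g i (block i x) (w k' i t))
  else x0.

Definition noise_independent (dT dE : measure_display) (T : measurableType dT)
    (E : measurableType dE) (R : realType) (P : probability T R) (N : nat)
    (w : nat -> 'I_N -> T -> E) : Prop :=
  forall k i, independent_sigma P (sigma_of (w k i))
    <<s \bigcup_(a in [set a : nat * 'I_N |
                        (a.1 < k)%N \/ (a.1 = k /\ a.2 <> i)])
          sigma_of (w a.1 a.2) >>.

(* x is the sequence of stacked iterates at which the oracle is queried. *)
Definition unbiased_oracle (dT : measure_display) (T : measurableType dT)
    (E : Type) (R : realType) (P : probability T R) (N d : nat)
    (f : 'I_N -> 'cV[R]_d -> R) (g : 'I_N -> 'cV[R]_d -> E -> 'cV[R]_d)
    (w : nat -> 'I_N -> T -> E) (x : nat -> T -> 'cV[R]_(N * d)) : Prop :=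
  forall k i (j : 'I_d),
    is_condexp P (sigma_of (fun t => block i (x k t) : borelcV R d))
      (fun t => g i (block i (x k t)) (w k i t) j 0)
      (fun t => grad (f i) (block i (x k t)) j 0).

Definition bounded_oracle_variance (dT : measure_display)
    (T : measurableType dT) (E : Type) (R : realType) (P : probability T R)
    (N d : nat) (sigma : R)
    (f : 'I_N -> 'cV[R]_d -> R) (g : 'I_N -> 'cV[R]_d -> E -> 'cV[R]_d)
    (w : nat -> 'I_N -> T -> E) (x : nat -> T -> 'cV[R]_(N * d)) : Prop :=
  forall k i, exists V : T -> R,
    is_condexp P (sigma_of (fun t => block i (x k t) : borelcV R d))
      (fun t => enorm (g i (block i (x k t)) (w k i t)
                       - grad (f i) (block i (x k t))) ^+ 2) V /\
    {ae P, forall t, V t <= sigma ^+ 2}.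

(* Main.v *)
Require Import Defs.
From HB Require Import structures.
From mathcomp Require Import all_boot all_order all_algebra.
From mathcomp Require Import fingroup perm complex mxtens.
From mathcomp Require Import all_classical all_reals all_analysis.
From mathcomp Require Import measurable_realfun ring lra.

Set Implicit Arguments.
Unset Strict Implicit.
Unset Printing Implicit Defensive.

Import Order.TTheory GRing.Theory Num.Theory.
Import numFieldNormedType.Exports.

Local Open Scope classical_set_scope.
Local Open Scope ring_scope.

(* Write A = I - W (acting blockwise) and grad_i for the gradient of f_i.  One
   noiseless step is x |-> x - (A x + alpha grad F x).  Both A and
   grad F - mu I are cocoercive, with constants 1 - lambda_N and L - mu, and a
   sum of cocoercive maps is cocoercive with the sum of the constants; the
   stepsize condition then makes the step a contraction of factor
   1 - alpha mu, with fixed point xinf.  The noise is orthogonal to everything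
   determined by the past: its mean given the i-th block only is 0, but w_i is
   independent of the whole past, so by Fubini the same holds given all the
   blocks.  Hence E |x_k - xinf|^2 satisfies u_(k+1) <= (1 - alpha mu)^2 u_k +
   alpha^2 N sigma^2, and the variance is the least mean square distance to a
   constant.  Finally, xinf minimizes <x, A x> / 2 + alpha F x, which bounds
   |grad F xinf| by comparison with 0; since A xinf = - alpha grad F xinf, the
   spectral gap of A bounds the distance from xinf to its block average, and
   strong convexity the distance from this average to xstar. *)

(** * Smooth strongly convex functions *)

Definition dot (R : realType) (n : nat) (x y : 'cV[R]_n) : R :=
  \sum_(i < n) x i 0 * y i 0.

Section dot_product.
Context {R : realType} {n : nat}.
Implicit Types x y z : 'cV[R]_n.

Lemma dotC x y : dot x y = dot y x.
Proof. by apply: eq_bigr => i _; rewrite mulrC. Qed.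

Lemma dotDl x y z : dot (x + y) z = dot x z + dot y z.
Proof. by rewrite /dot -big_split /=; apply: eq_bigr => i _; rewrite mxE mulrDl. Qed.

Lemma dotZl a x z : dot (a *: x) z = a * dot x z.
Proof. by rewrite /dot mulr_sumr; apply: eq_bigr => i _; rewrite mxE mulrA. Qed.

Lemma dotDr x y z : dot z (x + y) = dot z x + dot z y.
Proof. by rewrite ![dot z _]dotC dotDl. Qed.

Lemma dotZr a x z : dot z (a *: x) = a * dot z x.
Proof. by rewrite ![dot z _]dotC dotZl. Qed.

Lemma dotNl x z : dot (- x) z = - dot x z.
Proof. by rewrite -scaleN1r dotZl mulN1r. Qed.

Lemma dotNr x z : dot z (- x) = - dot z x.
Proof. by rewrite ![dot z _]dotC dotNl. Qed.

Lemma dot0l z : dot 0 z = 0.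
Proof. by rewrite -(scale0r (0 : 'cV_n)) dotZl mul0r. Qed.

Lemma dot0r z : dot z 0 = 0.
Proof. by rewrite dotC dot0l. Qed.

Lemma dot_ge0 x : 0 <= dot x x.
Proof. by apply: sumr_ge0 => i _; rewrite -expr2 sqr_ge0. Qed.

Lemma dot_eq0 x : (dot x x == 0) = (x == 0).
Proof.
apply/eqP/eqP => [/eqP|->]; last exact: dot0l.
rewrite /dot psumr_eq0 => [/allP h|i _]; last by rewrite -expr2 sqr_ge0.
apply/colP => i; rewrite mxE; apply/eqP.
by have := h i (mem_index_enum _); rewrite -expr2 sqrf_eq0.
Qed.

Lemma enorm_ge0 x : 0 <= enorm x.
Proof. exact: sqrtr_ge0. Qed.

Lemma enorm_sqr x : enorm x ^+ 2 = dot x x.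
Proof.
rewrite /enorm sqr_sqrtr; last by apply: sumr_ge0 => i _; rewrite sqr_ge0.
by apply: eq_bigr => i _; rewrite expr2.
Qed.

Lemma dot_sum_l (I : Type) (r : seq I) (Q : pred I) (F : I -> 'cV[R]_n) z :
  dot (\sum_(i <- r | Q i) F i) z = \sum_(i <- r | Q i) dot (F i) z.
Proof.
by apply: (big_morph (fun x => dot x z)) => [x y|]; rewrite ?dotDl ?dot0l.
Qed.

End dot_product.

Definition dotE := (@dotDl, @dotDr, @dotZl, @dotZr, @dotNl, @dotNr).

Section dot_inequalities.
Context {R : realType} {n : nat}.
Implicit Types x y z : 'cV[R]_n.

Lemma CauchySchwarz_dot x y : dot x y <= enorm x * enorm y.
Proof.
have := enorm_sqr x; have := enorm_sqr y.
have := enorm_ge0 x; have := enorm_ge0 y.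
move: (enorm x) (enorm y) => a b b0 a0 hb ha.
have h := dot_ge0 (b *: x - a *: y); have h2 := dot_ge0 (b *: x + a *: y).
rewrite !dotE (dotC y x) -ha -hb in h h2.
have [ab0|ab0] := ltP 0 (a * b); first by nra.
have /eqP : a * b = 0 by apply/eqP; rewrite eq_le ab0 mulr_ge0.
rewrite mulf_eq0 => /orP[/eqP a00|/eqP b00].
  have /eqP : dot x x = 0 by rewrite -ha a00 expr0n.
  by rewrite dot_eq0 => /eqP ->; rewrite dot0l a00 mul0r.
have /eqP : dot y y = 0 by rewrite -hb b00 expr0n.
by rewrite dot_eq0 => /eqP ->; rewrite dot0r b00 mulr0.
Qed.

Lemma ler_enorm_sqr x y : dot x x <= dot y y -> enorm x <= enorm y.
Proof. by rewrite -!enorm_sqr ler_sqr // nnegrE enorm_ge0. Qed.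

End dot_inequalities.

Section directional_derivative.
Context {R : realType}.

(** The two difference quotients are the same function of [h], because [A] sends the line through
    [a] along [v] to the line through [A a] along [u]. This serves both for restricting to a segment
    and for projecting onto a block. *)
Lemma derive_comp_affine (U V : normedModType R) (A : V -> U) (f : U -> R)
    (a v : V) (u : U) :
  (forall h, A (h *: v + a) = h *: u + A a) ->
  (derivable f (A a) u -> derivable (f \o A) a v) /\
  'D_v (f \o A) a = 'D_u f (A a).
Proof.
move=> hA; rewrite /derivable /derive.
have -> : (fun h : R => h^-1 *: (((f \o A) \o shift a) (h *: v) - (f \o A) a))
       = (fun h => h^-1 *: ((f \o shift (A a)) (h *: u) - f (A a))).
  by apply/funext => h; rewrite /= hA.
by [].
Qed.

Lemma derive_grad (n : nat) (f : 'cV[R]_n -> R) (x v : 'cV[R]_n) :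
  differentiable f x -> 'D_v f x = dot (grad f x) v.
Proof.
move=> df; rewrite deriveE // {1}(matrix_sum_delta v) /dot.
under eq_bigr do rewrite big_ord1.
rewrite linear_sum; apply: eq_bigr => i _.
by rewrite linearZ /= mxE deriveE // mulrC.
Qed.

End directional_derivative.

Lemma enormZ (R : realType) (n : nat) (a : R) (x : 'cV[R]_n) :
  0 <= a -> enorm (a *: x) = a * enorm x.
Proof.
move=> a0; apply/eqP; rewrite -(@eqrXn2 _ 2) ?enorm_ge0 ?mulr_ge0 ?enorm_ge0 //.
by rewrite exprMn !enorm_sqr !dotE mulrA expr2.
Qed.

Section smooth_strongly_convex.
Context {R : realType} {n : nat}.
Variables (mu L : R) (f : 'cV[R]_n -> R).
Hypothesis f_diff : forall x, differentiable f x.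

Let line (x v : 'cV[R]_n) (t : R) := x + t *: v.

Lemma is_derive_line x v t :
  is_derive t (1 : R) (f \o line x v) (dot (grad f (x + t *: v)) v).
Proof.
have hA h : line x v (h *: (1 : R) + t) = h *: v + line x v t.
  by rewrite /line [h *: 1]mulr1 scalerDl addrCA.
have [df dE] := derive_comp_affine f hA.
by apply: DeriveDef; [exact/df/diff_derivable|rewrite dE derive_grad].
Qed.

(** This is the mean value theorem on [0, 1] for f(x + t v) - t <grad f x, v> - s t^2. The free
    coefficient [s] replaces an integral along the segment: s = L/2 |v|^2 gives the sharp constant
    of the descent lemma. *)
Lemma mean_value_quadratic (s : R) x v :
  exists2 c : R, 0 <= c <= 1 &
    f (x + v) - f x - dot (grad f x) v - s =
    dot (grad f (x + c *: v) - grad f x) v - 2 * s * c.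
Proof.
pose psi t := f (line x v t) - t * dot (grad f x) v - s * t ^+ 2.
pose dpsi t := dot (grad f (x + t *: v) - grad f x) v - 2 * s * t.
have dpsiP t : is_derive t (1 : R) psi (dpsi t).
  have := is_derive_line x v t => ?.
  apply: is_derive_eq.
  by rewrite /dpsi !dotE /GRing.scale /=; ring.
have cpsi : {within `[0, 1], continuous psi}.
  by apply: derivable_within_continuous => t _; have [] := dpsiP t.
have [c] := MVT_segment ler01 (fun t _ => dpsiP t) cpsi.
rewrite in_itv /= => c01; rewrite subr0 mulr1 /psi /line scale1r scale0r addr0.
by move=> h; exists c => //; rewrite -/(dpsi c) -h; ring.
Qed.

Hypothesis f_lip : forall x y, enorm (grad f x - grad f y) <= L * enorm (x - y).

Lemma dot_grad_le x v c : 0 <= c ->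
  `|dot (grad f (x + c *: v) - grad f x) v| <= L * c * dot v v.
Proof.
move=> c0.
(* Cauchy-Schwarz is one-sided; taking e = 1 and e = -1 bounds the absolute value. *)
have h (e : R) : e ^+ 2 = 1 ->
    e * dot (grad f (x + c *: v) - grad f x) v <= L * c * dot v v.
  move=> e1; rewrite -dotZl; apply: le_trans (CauchySchwarz_dot _ _) _.
  have -> : enorm (e *: (grad f (x + c *: v) - grad f x)) =
            enorm (grad f (x + c *: v) - grad f x).
    by rewrite /enorm; congr Num.sqrt; apply: eq_bigr => i _;
      rewrite mxE exprMn e1 mul1r.
  rewrite -(enorm_sqr v) expr2 mulrA ler_wpM2r ?enorm_ge0 //.
  apply: le_trans (f_lip _ _) _.
  by rewrite addrAC subrr add0r enormZ // mulrA.
have h1 := h 1 (expr1n _ _); have := h (-1); rewrite sqrrN expr1n => /(_ erefl) h2.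
by rewrite ler_norml; lra.
Qed.

Lemma descent_lemma x v :
  f (x + v) <= f x + dot (grad f x) v + L / 2 * dot v v.
Proof.
have [c /andP[c0 _]] := mean_value_quadratic (L / 2 * dot v v) x v.
have := dot_grad_le x v c0; rewrite ler_norml => /andP[_ h] e.
by lra.
Qed.

Hypothesis L_ge0 : 0 <= L.

(** The constant L instead of L/2 is harmless: the bound is applied to t v with small t, where the
    quadratic term is of order t^2. *)
Lemma grad_lower_bound x v :
  f x + dot (grad f x) v - L * dot v v <= f (x + v).
Proof.
have [c /andP[c0 c1]] := mean_value_quadratic 0 x v.
have := dot_grad_le x v c0; rewrite ler_norml => /andP[h _] e.
have : L * c * dot v v <= L * dot v v.
  by rewrite ler_wpM2r ?dot_ge0 // ler_piMr.
lra.
Qed.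

Hypothesis mu_gt0 : 0 < mu.
Hypothesis f_conv : strongly_convex mu f.

Lemma strong_convexity_gradient x v :
  f x + dot (grad f x) v + mu / 2 * dot v v <= f (x + v).
Proof.
(* Strong convexity bounds f(x + t v) from above and [grad_lower_bound] bounds it from below;
   division by t leaves the claim up to an error linear in t. *)
have key t : 0 < t -> t <= 1 ->
    f x + dot (grad f x) v + mu / 2 * dot v v
      <= f (x + v) + t * ((L + mu / 2) * dot v v).
  move=> t0 t1; have := grad_lower_bound x (t *: v).
  have t01 : 0 <= t <= 1 by rewrite ltW.
  have := f_conv (x + v) x t01.
  have -> : t *: (x + v) + (1 - t) *: x = x + t *: v.
    by rewrite scalerDr addrAC -scalerDl addrCA subrr addr0 scale1r.
  have -> : x + v - x = v by rewrite addrAC subrr add0r.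
  rewrite enorm_sqr !dotE => h1 h2.
  rewrite -(ler_pM2l t0); lra.
rewrite leNgt; apply/negP => h.
set K := (L + mu / 2) * dot v v in key.
have K0 : 0 <= K by rewrite mulr_ge0 ?dot_ge0 // addr_ge0 // ltW // divr_gt0.
set a := f x + _ + _ in key h; set b := f (x + v) in key h.
(* For this t the error t K is at most (a - b) / 2, which contradicts [key]; K + 1 keeps the
   denominator positive when K = 0. *)
pose t := Num.min 1 ((a - b) / (2 * (K + 1))).
have t0 : 0 < t.
  by rewrite lt_min ltr01 divr_gt0 ?subr_gt0 // mulr_gt0 // ltr_wpDl.
have t1 : t <= 1 by rewrite ge_min lexx.
have := key t t0 t1.
have : t <= (a - b) / (2 * (K + 1)) by rewrite ge_min lexx orbT.
rewrite ler_pdivlMr ?mulr_gt0 // ?ltr_wpDl // => h1 h2; nra.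
Qed.

Let tilted x y := grad f x - grad f y - mu *: (x - y).

(* Baillon-Haddad for h = f - mu/2 |.|^2, which is convex and M-smooth:
   compare h with its tangents at x and y in the point where the quadratic
   upper model of h at y, tilted by grad h x, is minimal. *)
Lemma grad_cocoercive M x y : 0 < M -> L - mu <= M ->
  dot (tilted x y) (tilted x y) <= M * dot (tilted x y) (x - y).
Proof.
move=> M0 LM.
have step u w : (2 * M)^-1 * dot (tilted u w) (tilted u w) <=
    f w - f u - dot (grad f u) (w - u)
        - mu / 2 * dot (w - u) (w - u).
  set z := w - u + M^-1 *: tilted u w.
  have h1 := strong_convexity_gradient u z.
  have h2 := descent_lemma w (M^-1 *: tilted u w).
  have uz : u + z = w + M^-1 *: tilted u w by rewrite /z addrA [u + _]addrC subrK.
  rewrite uz in h1; have := le_trans h1 h2.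
  have hd : grad f u = tilted u w + grad f w - mu *: (w - u).
    by apply/colP => i; rewrite !mxE; ring.
  rewrite /z hd; move: (w - u) (grad f w) (tilted u w) => p gw d.
  rewrite !dotE (dotC p d).
  have dd := dot_ge0 d.
  have MM : M * M^-1 = 1 by rewrite mulfV // gt_eqF.
  have M'0 : 0 < M^-1 by rewrite invr_gt0.
  rewrite invfM; move: (M^-1) MM M'0 => m MM M'0 h.
  have h3 : m * m * (L - mu) * dot d d <= m * dot d d.
    rewrite ler_wpM2r //; have : m * m * (L - mu) <= m * m * M.
      by rewrite ler_wpM2l // mulr_ge0 // ltW.
    by rewrite -[m * m * M]mulrA (mulrC m M) MM mulr1.
  lra.
have h1 := step x y; have h2 := step y x.
have e1 : tilted y x = - tilted x y.
  by apply/colP => i; rewrite !mxE; ring.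
have hq : dot (tilted x y) (x - y) = dot (grad f x) (x - y)
    - dot (grad f y) (x - y) - mu * dot (x - y) (x - y).
  by rewrite /tilted; move: (x - y) => v; rewrite !dotE.
move: h2; rewrite e1 dotNl dotNr opprK => h2.
have h3 : M^-1 * dot (tilted x y) (tilted x y) <= dot (tilted x y) (x - y).
  rewrite hq; move: h1; rewrite -(opprB x y) !dotNl !dotNr !opprK invfM => h1.
  rewrite invfM in h2; lra.
by move: h3; rewrite mulrC ler_pdivrMr // [X in _ <= X]mulrC.
Qed.

(** A gradient step of length 1/L lowers f by at least |grad f x|^2 / (2 L), and the value reached
    is still at least the infimum. *)
Lemma grad_sqr_le_gap x : 0 < L ->
  dot (grad f x) (grad f x) <= 2 * L * (f x - min_value f).
Proof.
move=> L0; have h := descent_lemma x (- L^-1 *: grad f x).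
have inf_le : min_value f <= f (x + - L^-1 *: grad f x).
  apply: ge_inf; last by exists (x + - L^-1 *: grad f x).
  (* The infimum is a lower bound only if the range is bounded below. The witness is the minimum
     over y of the quadratic f 0 + <grad f 0, y> + mu/2 |y|^2. *)
  exists (f 0 - (2 * mu)^-1 * dot (grad f 0) (grad f 0)) => _ [y _ <-].
  have := strong_convexity_gradient 0 y; rewrite add0r.
  have := dot_ge0 (grad f 0 + mu *: y).
  rewrite !dotE (dotC y); set a := dot _ _; set b := dot _ _; set c := dot _ _.
  rewrite invfM -(pmulr_rge0 _ (_ : 0 < mu^-1)) ?invr_gt0 //.
  rewrite !mulrDr !mulrA mulVf ?gt_eqF // !mul1r; lra.
have := le_trans inf_le h; rewrite !dotE.
set a := dot _ _; set b := f x; set c := min_value f => h'.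
rewrite mulrC -ler_pdivrMr ?mulr_gt0 //.
have LL : L * L^-1 = 1 by rewrite mulfV ?gt_eqF.
have -> : a / (2 * L) = L^-1 * a - L / 2 * (L^-1 * L^-1 * a).
  by rewrite invfM; field; rewrite gt_eqF.
lra.
Qed.

End smooth_strongly_convex.

(** * Spectrum of a mixing matrix *)

Section spectral_coefficients.
Local Open Scope complex_scope.
Context {R : realType} {n : nat}.
Variable W : 'M[R]_n.
Hypothesis W_sym : W^T = W.

Local Notation toC := (map_mx (real_complex R)).

(** Over the complex numbers W is Hermitian, hence unitarily diagonalizable with real eigenvalues;
    the rows of [U] are its left eigenvectors, and similarity preserves the characteristic
    polynomial. *)
Lemma symmetric_spectral : exists (r : 'I_n -> R) (U : 'M[R[i]]_n),
  [/\ U *m (map_mx Num.conj U)^T = 1%:M,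
      forall k j, \sum_i U k i * (W i j)%:C = (r k)%:C * U k j
    & char_poly W = \prod_k ('X - (r k)%:P)].
Proof.
have Wherm : toC W \is hermsymmx.
  apply: realsym_hermsym; last first.
    by apply/mxOverP => i j; rewrite mxE; apply/complex_realP; exists (W i j).
  apply/is_hermitianmxP; rewrite expr0 scale1r; apply/matrixP => i j.
  by rewrite !mxE -{1}W_sym mxE.
have Wnorm := hermitian_normalmx Wherm.
have /mxOverP Dreal := hermitian_spectral_diag_real Wherm.
have /orthomx_spectralP WE := Wnorm.
have := spectral_unitarymx (toC W); have := spectral_unit (toC W).
move: (spectralmx _) (spectral_diag _) WE Dreal => U D WE Dreal Uunit Uunitary.
pose r k := complex.Re (D 0 k).
have rE k : (r k)%:C = D 0 k by rewrite RRe_real.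
exists r, U; split.
- by have /unitarymxP := Uunitary; rewrite map_trmx.
- move=> k j; have : U *m toC W = diag_mx D *m U.
    by rewrite WE !mulmxA mulmxV // mul1mx.
  move=> /matrixP /(_ k j); rewrite mul_diag_mx !mxE rE => <-.
  by apply: eq_bigr => i _; rewrite mxE.
- apply: (map_poly_inj (real_complex R)).
  rewrite map_char_poly rmorph_prod /=.
  under eq_bigr do rewrite rmorphB /= map_polyX map_polyC /= rE.
  have UU : map_mx polyC (invmx U) *m map_mx polyC U = 1%:M.
    by rewrite -map_mxM mulVmx // map_mx1.
  rewrite WE /char_poly /char_poly_mx.
  have -> : 'X%:M - map_mx polyC (invmx U *m diag_mx D *m U) =
    map_mx polyC (invmx U) *m ('X%:M - map_mx polyC (diag_mx D)) *m map_mx polyC U.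
    rewrite mulmxBr mulmxBl !map_mxM.
    by rewrite (scalar_mxC _ (map_mx polyC (invmx U))) -(mulmxA 'X%:M) UU mulmx1.
  rewrite !det_mulmx mulrAC -det_mulmx -map_mxM mulVmx // map_mx1 det1 mul1r.
  have -> : 'X%:M - map_mx polyC (diag_mx D) = diag_mx (\row_k ('X - (D 0 k)%:P)).
    apply/matrixP => i j; rewrite !mxE; case: eqP => [->|_] //=.
    by rewrite !mulr0n polyC0 subrr.
  by rewrite det_diag; apply: eq_bigr => k _; rewrite mxE.
Qed.

(** [X k] and [Y k] are the real and imaginary parts of the k-th row of the unitary matrix. Since W
    and [r k] are real, each part satisfies the eigenvector equation by itself, so spectral sums can
    be written over the reals without a real orthonormal eigenbasis. *)
Lemma symmetric_spectral_real :
  exists (r : 'I_n -> R) (X Y : 'I_n -> 'cV[R]_n),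
  [/\ forall k, W *m X k = r k *: X k /\ W *m Y k = r k *: Y k,
      forall k l, dot (X k) (X l) + dot (Y k) (Y l) = (k == l)%:R,
      forall k l, dot (X k) (Y l) = dot (Y k) (X l),
      forall x y, dot x y = \sum_k (dot (X k) x * dot (X k) y +
                                    dot (Y k) x * dot (Y k) y)
    & char_poly W = \prod_k ('X - (r k)%:P)].
Proof.
have [r [U [UU Ueig chE]]] := symmetric_spectral.
have ReD (z w : R[i]) : complex.Re (z + w) = complex.Re z + complex.Re w.
  by case: z w => ? ? [].
have ImD (z w : R[i]) : complex.Im (z + w) = complex.Im z + complex.Im w.
  by case: z w => ? ? [].
have Re_sum (I : finType) (F : I -> R[i]) :
    complex.Re (\sum_i F i) = \sum_i complex.Re (F i).
  by apply: (big_morph (@complex.Re R)).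
have Im_sum (I : finType) (F : I -> R[i]) :
    complex.Im (\sum_i F i) = \sum_i complex.Im (F i).
  by apply: (big_morph (@complex.Im R)).
have ReM (z w : R[i]) : complex.Re (z * w) =
    complex.Re z * complex.Re w - complex.Im z * complex.Im w.
  by case: z w => ? ? [].
have ImM (z w : R[i]) : complex.Im (z * w) =
    complex.Re z * complex.Im w + complex.Im z * complex.Re w.
  by case: z w => ? ? [] ? ? /=; rewrite addrC.
have ReJ (z : R[i]) : complex.Re (Num.conj z) = complex.Re z by case: z.
have ImJ (z : R[i]) : complex.Im (Num.conj z) = - complex.Im z by case: z.
exists r, (fun k => \col_j complex.Re (U k j)), (fun k => \col_j complex.Im (U k j)).
(* Orthonormality of the rows yields the two relations between indices k and l; orthonormality of
   the columns, stated here, yields the Parseval identity. *)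
have UV : (map_mx Num.conj U)^T *m U = 1%:M by exact: mulmx1C.
split=> //.
- move=> k; split; apply/colP => j; rewrite !mxE.
    have /(congr1 (@complex.Re R)) := Ueig k j.
    rewrite Re_sum ReM /= mul0r subr0 => <-; apply: eq_bigr => i _.
    by rewrite mxE ReM /= mulr0 subr0 mulrC -[in RHS]W_sym mxE.
  have /(congr1 (@complex.Im R)) := Ueig k j.
  rewrite Im_sum ImM /= mul0r addr0 => <-; apply: eq_bigr => i _.
  by rewrite mxE ImM /= mulr0 add0r mulrC -[in RHS]W_sym mxE.
- move=> k l; have /matrixP/(_ k l)/(congr1 (@complex.Re R)) := UU.
  rewrite !mxE Re_sum -big_split /= => h.
  rewrite (_ : (k == l)%:R = complex.Re (k == l)%:R); last by case: (k == l).
  rewrite -h; apply: eq_bigr => j _.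
  by rewrite !mxE ReM ReJ ImJ mulrN opprK.
- move=> k l; have /matrixP/(_ k l)/(congr1 (@complex.Im R)) := UU.
  rewrite !mxE Im_sum (_ : complex.Im (k == l)%:R = 0); last by case: (k == l).
  move=> h; apply/eqP; rewrite eq_sym -subr_eq0 /dot -sumrB; apply/eqP; rewrite -[RHS]h.
  apply: eq_bigr => j _; rewrite !mxE ImM ReJ ImJ; ring.
- move=> x y; under [RHS]eq_bigr do rewrite /dot !big_distrlr /= -big_split /=.
  rewrite exchange_big /=; apply: eq_bigr => i _.
  under [RHS]eq_bigr do rewrite -big_split /=.
  rewrite exchange_big /= (bigD1 i) //= [X in _ = _ + X]big1 => [|j ji].
    have /matrixP/(_ i i)/(congr1 (@complex.Re R)) := UV.
    rewrite !mxE Re_sum eqxx /= addr0 => h.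
    rewrite -[LHS]mulr1 -h mulr_sumr; apply: eq_bigr => k _.
    by rewrite !mxE ReM ReJ ImJ; ring.
  have /matrixP/(_ i j)/(congr1 (@complex.Re R)) := UV.
  rewrite !mxE Re_sum eq_sym (negbTE ji) /= => h.
  transitivity (x i 0 * y j 0 * 0); last by rewrite mulr0.
  rewrite -[in RHS]h mulr_sumr; apply: eq_bigr => k _.
  by rewrite !mxE ReM ReJ ImJ; ring.
Qed.

End spectral_coefficients.

Section mixing.
Context {R : realType} {N : nat}.
Variables (e : rel 'I_N) (W : 'M[R]_N).
Hypothesis e_conn : connected_graph e.
Hypothesis W_mix : mixing_matrix e W.

Lemma mixing_sum1 i : \sum_j W i j = 1.
Proof. by have [_ [_ [h _]] _ _] := W_mix. Qed.

(** The square is expanded, and the row and column sums equal to 1 turn the pure terms into |x|^2.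
    This Dirichlet form of the graph Laplacian shows that I - W is positive semidefinite and
    identifies its kernel. *)
Lemma mixing_dirichlet (x : 'cV[R]_N) :
  2 * (dot x x - dot (W *m x) x) = \sum_i \sum_j W i j * (x i 0 - x j 0) ^+ 2.
Proof.
have [_ [_ [Wr Wc]] _ _] := W_mix.
transitivity (\sum_i \sum_j (W i j * x i 0 ^+ 2 + W i j * x j 0 ^+ 2
                             - 2 * (W i j * x j 0 * x i 0))); last first.
  by apply: eq_bigr => i _; apply: eq_bigr => j _; ring.
under eq_bigr do rewrite sumrB big_split /=.
rewrite sumrB big_split /=.
have -> : \sum_i \sum_j W i j * x i 0 ^+ 2 = dot x x.
  by apply: eq_bigr => i _; rewrite -mulr_suml Wr mul1r expr2.
have -> : \sum_i \sum_j W i j * x j 0 ^+ 2 = dot x x.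
  rewrite exchange_big; apply: eq_bigr => i _.
  by rewrite -mulr_suml Wc mul1r expr2.
have -> : \sum_i \sum_j 2 * (W i j * x j 0 * x i 0) = 2 * dot (W *m x) x.
  rewrite /dot mulr_sumr; apply: eq_bigr => i _.
  by rewrite -mulr_sumr -mulr_suml mxE.
ring.
Qed.

Lemma mixing_dot_le (x : 'cV[R]_N) : dot (W *m x) x <= dot x x.
Proof.
have [_ [W0 _] _ _] := W_mix.
have := mixing_dirichlet x; rewrite -subr_ge0 => h.
rewrite -(pmulr_rge0 _ (ltr0Sn R 1)) h.
by apply: sumr_ge0 => i _; apply: sumr_ge0 => j _; rewrite mulr_ge0 ?sqr_ge0.
Qed.

(** The Dirichlet form vanishes at x, so each of its nonnegative terms does, and x agrees at the
    ends of every edge; connectedness propagates this along paths. *)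
Lemma mixing_fixed_const (x : 'cV[R]_N) : W *m x = x ->
  forall i j, x i 0 = x j 0.
Proof.
have [_ [W0 _] We _] := W_mix; have [_ conn] := e_conn.
move=> Wx; have := mixing_dirichlet x; rewrite Wx subrr mulr0 => /esym h.
have step i j : e i j -> x i 0 = x j 0.
  move=> eij; have [->//|ij] := eqVneq i j.
  have Wij : 0 < W i j by have [+ _] := We _ _ ij; apply.
  have pos k l : 0 <= W k l * (x k 0 - x l 0) ^+ 2 by rewrite mulr_ge0 ?sqr_ge0.
  have := psumr_eq0P (fun k _ => sumr_ge0 _ (fun l _ => pos k l)) h.
  move=> /(_ i isT) hi; have := psumr_eq0P (fun l _ => pos i l) hi.
  move=> /(_ j isT)/eqP; rewrite mulf_eq0 gt_eqF //= sqrf_eq0 subr_eq0.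
  by move/eqP.
move=> i j; have /connectP[p pth ->] := conn i j.
elim: p i pth => //= k p IH i /andP[eik pth].
by rewrite (step _ _ eik); exact: IH.
Qed.

Variable lam : N.-tuple R.
Hypothesis lam_eig : ordered_eigenvalues W lam.
Hypothesis N_gt1 : (1 < N)%N.

Let lam_anti i j : (i <= j < N)%N -> lam`_j <= lam`_i.
Proof.
have [lam_sorted _] := lam_eig.
move=> /andP[ij jN].
have /= := sorted_leq_nth (fun x y z h1 h2 => ge_trans h1 h2) lexx 0 lam_sorted.
by apply=> //; rewrite inE size_tuple //; apply: leq_ltn_trans jN.
Qed.

Let one : 'cV[R]_N := const_mx 1.

Let W_one : W *m one = one.
Proof.
by apply/colP => i; rewrite !mxE -[RHS](mixing_sum1 i); apply: eq_bigr => j _;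
  rewrite mxE mulr1.
Qed.

Let dot_W x y : dot (W *m x) y = dot x (W *m y).
Proof.
have [Wsym _ _ _] := W_mix.
rewrite /dot; under eq_bigr do rewrite mxE mulr_suml.
rewrite exchange_big /=; apply: eq_bigr => j _; rewrite mxE mulr_sumr.
by apply: eq_bigr => i _; rewrite -[in LHS]Wsym mxE; ring.
Qed.

(* The numbers [c u k] are the masses of the spectral measure of W at u. *)
Lemma mixing_spectral_measure : exists (r : 'I_N -> R) (c : 'cV[R]_N -> 'I_N -> R),
  [/\ (forall u k, 0 <= c u k) /\ (forall k, lam`_(N.-1) <= r k <= 1),
      forall u, [/\ dot u u = \sum_k c u k,
        dot (u - W *m u) u = \sum_k (1 - r k) * c u k &
        dot (u - W *m u) (u - W *m u) = \sum_k (1 - r k) ^+ 2 * c u k],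
      lam`_1 < 1
    & forall u k, dot one u = 0 -> c u k = 0 \/ r k <= lam`_1].
Proof.
have [Wsym _ _ _] := W_mix.
have [r [X [Y [WXY on1 on2 pars chE]]]] := symmetric_spectral_real Wsym.
have r_le1 k : r k <= 1.
  have [WX WY] := WXY k; have := mixing_dot_le (X k); have := mixing_dot_le (Y k).
  rewrite WX WY !dotZl; have := on1 k k; rewrite eqxx => /= h h1 h2.
  have : r k * (dot (X k) (X k) + dot (Y k) (Y k)) <= 1 by rewrite -[X in _ <= X]h; lra.
  by rewrite h mulr1.
(* Both families are the roots of the characteristic polynomial with multiplicity, so they agree up
   to a permutation. *)
have [s lamE] : exists s : {perm 'I_N}, forall i : 'I_N, lam`_i = r (s i).
  have : perm_eq lam [tuple r i | i < N].
    apply: prod_XsubC_eq; have [_ <-] := lam_eig.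
    by rewrite chE big_map big_enum.
  case/tuple_permP => s sE; exists s => i.
  rewrite -tnth_nth (_ : lam = [tuple tnth [tuple r i | i < N] (s i) | i < N]).
    by rewrite !tnth_mktuple.
  exact: val_inj.
have rE k : r k = lam`_(s^-1%g k) by rewrite lamE permKV.
pose i0 := Ordinal (ltnW N_gt1); pose i1 := Ordinal N_gt1.
have const k : r k = 1 -> exists a b, X k = a *: one /\ Y k = b *: one.
  move=> rk; have [] := WXY k; rewrite rk !scale1r => WX WY.
  exists (X k i0 0), (Y k i0 0); split; apply/colP => j; rewrite !mxE mulr1.
    exact: mixing_fixed_const WX _ _.
  exact: mixing_fixed_const WY _ _.
have dot_one : dot one one = N%:R.
  rewrite /dot; under eq_bigr do rewrite !mxE mulr1.
  by rewrite sumr_const card_ord.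
have N0 : (0 : R) < N%:R by rewrite ltr0n ltnW.
(* Were all eigenvalues below 1, symmetry of W would make every [X k] and [Y k] orthogonal to [one],
   and Parseval would give |one|^2 = 0 instead of N. *)
have lam0 : lam`_0 = 1.
  apply/eqP; rewrite eq_le (lamE i0) r_le1 /= -(lamE i0) /=.
  rewrite leNgt; apply/negP => lam0.
  have r_lt1 k : r k < 1.
    by rewrite rE; apply: le_lt_trans lam0; apply: lam_anti; rewrite leq0n /=.
  have z (Z : 'cV[R]_N) k : W *m Z = r k *: Z -> dot Z one = 0.
    move=> WZ; have := dot_W Z one; rewrite WZ W_one dotZl => /eqP.
    rewrite -subr_eq0 -[X in _ - X]mul1r -mulrBl mulf_eq0 subr_eq0.
    by rewrite lt_eqF //= => /eqP.
  have := pars one one; rewrite dot_one big1 => [/eqP|k _].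
    by rewrite gt_eqF.
  by have [WX WY] := WXY k; rewrite !(z _ k) // mulr0 addr0.
(* Were the eigenvalue 1 double, the rows [s i0] and [s i1] of the unitary matrix would both be
   complex multiples of [one], by connectedness, and yet be orthogonal. *)
have lam1 : lam`_1 < 1.
  rewrite lt_neqAle (lamE i1) r_le1 andbT; apply/eqP => r1.
  have r0 : r (s i0) = 1 by rewrite -lamE.
  have [a [b [Xa Yb]]] := const _ r0; have [a' [b' [Xa' Yb']]] := const _ r1.
  have := on1 (s i0) (s i0); have := on1 (s i1) (s i1).
  have := on1 (s i0) (s i1); have := on2 (s i0) (s i1).
  rewrite !eqxx (inj_eq perm_inj) Xa Yb Xa' Yb' !dotE dot_one /= => h1 h2 h3 h4.
  have e1 : a * b' = b * a'.
    by apply/(mulIf (lt0r_neq0 N0)); rewrite -!mulrA.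
  have e2 : a * a' + b * b' = 0.
    by apply/(mulIf (lt0r_neq0 N0)); rewrite mul0r mulrDl -!mulrA.
  (* By multiplicativity of the complex modulus, orthogonality forces one of the multipliers a + ib
     and a' + ib' to vanish, although both rows have norm 1. *)
  have : (a ^+ 2 + b ^+ 2) * (a' ^+ 2 + b' ^+ 2) = 0.
    transitivity ((a * a' + b * b') ^+ 2 + (a * b' - b * a') ^+ 2); first by ring.
    by rewrite e2 e1 subrr !expr0n addr0.
  move=> /eqP; rewrite mulf_eq0 => /orP[] /eqP h0.
    move: h4; rewrite (_ : _ + _ = N%:R * (a ^+ 2 + b ^+ 2)); last by ring.
    by rewrite h0 mulr0 => /eqP; rewrite eq_sym oner_eq0.
  move: h3; rewrite (_ : _ + _ = N%:R * (a' ^+ 2 + b' ^+ 2)); last by ring.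
  by rewrite h0 mulr0 => /eqP; rewrite eq_sym oner_eq0.
have dotA Z k u : W *m Z = r k *: Z -> dot Z (u - W *m u) = (1 - r k) * dot Z u.
  by move=> WZ; rewrite dotDr dotNr -dot_W WZ dotZl; ring.
exists r, (fun u k => dot (X k) u ^+ 2 + dot (Y k) u ^+ 2); split=> //.
- split=> [u k|k]; first by rewrite addr_ge0 ?sqr_ge0.
  rewrite r_le1 andbT rE; apply: lam_anti.
  by rewrite -ltnS prednK ?ltn_ord ?leqnn // ltnW.
- move=> u; rewrite !pars; split; apply: eq_bigr => k _; have [WX WY] := WXY k;
  rewrite ?(dotA _ k _ WX) ?(dotA _ k _ WY); ring.
(* The index matched with the top eigenvalue 1 carries multiples of [one], hence no mass at u; every
   other index is matched with a later place of the decreasing list, so its eigenvalue is at most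
   lambda_2. *)
- move=> u k u1; have [k0|k0] := eqVneq (s^-1%g k) i0.
    left; have [|a [b [-> ->]]] := const k; first by rewrite rE k0.
    by rewrite !dotZl u1 !mulr0 expr0n addr0.
  right; rewrite rE; apply: lam_anti; rewrite ltn_ord andbT lt0n.
  by apply: contra k0 => /eqP h; apply/eqP/val_inj.
Qed.

(** On the spectrum 0 <= 1 - r <= 1 - lambda_N, so (1 - r)^2 <= (1 - lambda_N)(1 - r) holds mass by
    mass. *)
Lemma laplacian_cocoercive (u : 'cV[R]_N) :
  dot (u - W *m u) (u - W *m u) <= (1 - lam`_(N.-1)) * dot (u - W *m u) u.
Proof.
have [r [c [[c0 rb] cE _ _]]] := mixing_spectral_measure.
have [_ -> ->] := cE u; rewrite mulr_sumr ler_sum // => k _.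
have /andP[h1 h2] := rb k; rewrite mulrA ler_wpM2r // expr2.
by rewrite ler_wpM2r ?subr_ge0 // lerB.
Qed.

(** Orthogonality to the constants removes the mass at the top eigenvalue, and 1 - r >= 1 - lambda_2
    on the rest. *)
Lemma laplacian_gap (u : 'cV[R]_N) : dot one u = 0 ->
  (1 - lam`_1) ^+ 2 * dot u u <= dot (u - W *m u) (u - W *m u).
Proof.
have [r [c [[c0 rb] cE l1 gap]]] := mixing_spectral_measure.
move=> u1; have [-> _ ->] := cE u; rewrite mulr_sumr ler_sum // => k _.
have [->|h] := gap u k u1; first by rewrite !mulr0.
by rewrite ler_wpM2r // ler_sqr ?nnegrE ?subr_ge0 ?(ltW l1) ?lerB // (le_trans h (ltW l1)).
Qed.

Lemma lam1_lt1 : lam`_1 < 1.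
Proof. by have [r [c []]] := mixing_spectral_measure. Qed.

Lemma lamN_le_lam1 : lam`_(N.-1) <= lam`_1.
Proof. by apply: lam_anti; rewrite -ltnS prednK ?N_gt1 ?leqnn // ltnW. Qed.

End mixing.

(** * The noiseless iteration *)

Section blocks.
Context {R : realType} {N d : nat}.
Implicit Types x y : 'cV[R]_(N * d).

(** This is the slicing transverse to [block]: the Kronecker product acts on each slice as W itself,
    so the spectral estimates apply slice by slice, while gradients act block by block. *)
Definition coords (j : 'I_d) x : 'cV[R]_N := \col_i x (mxtens_index (i, j)) 0.

Lemma sum_mxtens (F : 'I_(N * d) -> R) :
  \sum_k F k = \sum_i \sum_j F (mxtens_index (i, j)).
Proof.
rewrite pair_big /= (reindex (fun p : 'I_N * 'I_d => mxtens_index p)) /=.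
  by apply: eq_bigr => -[i j].
by exists (@mxtens_unindex _ _) => ? _; rewrite ?mxtens_indexK ?mxtens_unindexK.
Qed.

Lemma dot_block x y : dot x y = \sum_i dot (block i x) (block i y).
Proof.
rewrite /dot sum_mxtens; apply: eq_bigr => i _; apply: eq_bigr => j _.
by rewrite !mxE.
Qed.

Lemma dot_coords x y : dot x y = \sum_j dot (coords j x) (coords j y).
Proof.
rewrite dot_block /dot exchange_big; apply: eq_bigr => j _.
by apply: eq_bigr => i _; rewrite !mxE.
Qed.

Lemma blockD i x y : block i (x + y) = block i x + block i y.
Proof. by apply/colP => j; rewrite !mxE. Qed.

Lemma blockZ i a x : block i (a *: x) = a *: block i x.
Proof. by apply/colP => j; rewrite !mxE. Qed.

Lemma blockN i x : block i (- x) = - block i x.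
Proof. by apply/colP => j; rewrite !mxE. Qed.

Lemma block_stack i (u : 'I_N -> 'cV[R]_d) : block i (stack u) = u i.
Proof. by apply/colP => j; rewrite !mxE mxtens_indexK. Qed.

Lemma coordsD j x y : coords j (x + y) = coords j x + coords j y.
Proof. by apply/colP => i; rewrite !mxE. Qed.

Lemma coordsN j x : coords j (- x) = - coords j x.
Proof. by apply/colP => i; rewrite !mxE. Qed.

Lemma coordsZ j a x : coords j (a *: x) = a *: coords j x.
Proof. by apply/colP => i; rewrite !mxE. Qed.

Lemma coords_kron j (W : 'M[R]_N) x :
  coords j (kron_id d W *m x) = W *m coords j x.
Proof.
apply/colP => i; rewrite !mxE.
rewrite sum_mxtens; apply: eq_bigr => k _; rewrite (bigD1 j) //= big1 => [|l lj].
  by rewrite /kron_id tensmxE !mxE eqxx mulr1 addr0.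
by rewrite /kron_id tensmxE !mxE eq_sym (negbTE lj) mulr0 mul0r.
Qed.

(** A basis direction of index (a, b) moves only block a, along the b-th axis, so a single summand
    contributes to the partial derivative. *)
Lemma grad_sum_blocks (f : 'I_N -> 'cV[R]_d -> R) x :
  (forall i (z : 'cV[R]_d), differentiable (f i) z) ->
  grad (sum_blocks f) x = stack (fun i => grad (f i) (block i x)).
Proof.
move=> f_diff; apply/colP => k; case: (mxtens_indexP k) => a b {k}.
rewrite !mxE mxtens_indexK /=; set v : 'cV[R]_(N * d) := delta_mx _ _.
have -> : sum_blocks f = \sum_i (f i \o block i).
  by apply/funext => y; rewrite fct_sumE.
have hA i h : block i (h *: v + x) = h *: block i v + block i x.
  by rewrite blockD blockZ.
have blockv i : block i v = (i == a)%:R *: delta_mx b 0.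
  apply/colP => j; rewrite !mxE (can_eq (@mxtens_indexK _ _)) !andbT xpair_eqE.
  by case: (i == a); rewrite ?mul1r ?mul0r.
rewrite derive_sum => [|i]; last first.
  have [h _] := derive_comp_affine (f i) (hA i); apply: h; exact: diff_derivable.
rewrite (bigD1 a) //= big1 ?addr0 => [|i ia].
  have [_ ->] := derive_comp_affine (f a) (hA a).
  by rewrite blockv eqxx scale1r.
have [_ ->] := derive_comp_affine (f i) (hA i).
by rewrite blockv (negbTE ia) scale0r derive_grad // dot0r.
Qed.

End blocks.

(** The inequality |a + b|^2 / (b1 + b2) <= |a|^2 / b1 + |b|^2 / b2 does it; after clearing
    denominators its defect is |b2 a - b1 b|^2. *)
Lemma cocoercive_add (R : realType) (n : nat) (b1 b2 : R) (u a b : 'cV[R]_n) :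
  0 < b1 -> 0 < b2 -> dot a a <= b1 * dot a u -> dot b b <= b2 * dot b u ->
  dot (a + b) (a + b) <= (b1 + b2) * dot (a + b) u.
Proof.
move=> b10 b20 ha hb.
have := dot_ge0 (b2 *: a - b1 *: b).
rewrite !dotE (dotC b a) => h.
rewrite -(ler_pM2l (mulr_gt0 b10 b20)).
have h1 : b2 * (b1 + b2) * dot a a <= b2 * (b1 + b2) * (b1 * dot a u).
  by rewrite ler_wpM2l // mulr_ge0 ?addr_ge0 ?ltW.
have h2 : b1 * (b1 + b2) * dot b b <= b1 * (b1 + b2) * (b2 * dot b u).
  by rewrite ler_wpM2l // mulr_ge0 ?addr_ge0 ?ltW.
lra.
Qed.

(** * Contraction of the noiseless step and location of its fixed point *)

Section dgd.
Context {R : realType} {N d : nat}.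
Variables (mu L : R) (f : 'I_N -> 'cV[R]_d -> R).
Hypotheses (mu_gt0 : 0 < mu) (mu_le_L : mu <= L).
Hypothesis f_conv : forall i, strongly_convex mu (f i).
Hypothesis f_lip : forall i, lipschitz_gradient L (f i).
Variables (e : rel 'I_N) (W : 'M[R]_N) (lam : N.-tuple R).
Hypothesis N_gt1 : (1 < N)%N.
Hypothesis e_conn : connected_graph e.
Hypothesis W_mix : mixing_matrix e W.
Hypothesis lam_eig : ordered_eigenvalues W lam.
Variable alpha : R.
Hypothesis alpha_gt0 : 0 < alpha.
Hypothesis alpha_lt : alpha < (1 + lam`_(N.-1)) / (mu + L).

Let L_gt0 : 0 < L. Proof. exact: lt_le_trans mu_le_L. Qed.
Let f_diff i : forall x, differentiable (f i) x. Proof. by have [] := f_lip i. Qed.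
Let f_lip' i : forall x y, enorm (grad (f i) x - grad (f i) y) <= L * enorm (x - y).
Proof. by have [] := f_lip i. Qed.
Let lamN_lt1 : lam`_(N.-1) < 1.
Proof.
exact: le_lt_trans (lamN_le_lam1 lam_eig N_gt1)
  (lam1_lt1 e_conn W_mix lam_eig N_gt1).
Qed.
Let alphaML : alpha * (mu + L) < 1 + lam`_(N.-1).
Proof. by rewrite -ltr_pdivlMr // addr_gt0. Qed.

Lemma alpha_mu_lt1 : alpha * mu < 1.
Proof.
have : alpha * mu <= alpha * L by rewrite ler_pM2l.
have := alphaML; have := lamN_lt1; lra.
Qed.

Definition stacked_grad x : 'cV[R]_(N * d) :=
  stack (fun i => grad (f i) (block i x)).

Definition dgd_step x := kron_id d W *m x - alpha *: stacked_grad x.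

Lemma kron_laplacian_cocoercive (u : 'cV[R]_(N * d)) :
  let a := u - kron_id d W *m u in
  dot a a <= (1 - lam`_(N.-1)) * dot a u.
Proof.
rewrite /= !dot_coords mulr_sumr; apply: ler_sum => j _.
rewrite coordsD coordsN coords_kron.
exact: (laplacian_cocoercive e_conn W_mix lam_eig N_gt1).
Qed.

Lemma dgd_step_contraction x y :
  dot (dgd_step x - dgd_step y) (dgd_step x - dgd_step y) <=
  (1 - alpha * mu) ^+ 2 * dot (x - y) (x - y).
Proof.
set u := x - y.
pose a := u - kron_id d W *m u.
pose q := stacked_grad x - stacked_grad y - mu *: u.
have -> : dgd_step x - dgd_step y = (1 - alpha * mu) *: u - (a + alpha *: q).
  rewrite /dgd_step /a /q /u mulmxBr; move: (kron_id d W *m x) (kron_id d W *m y).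
  by move=> p r; apply/colP => i; rewrite !mxE; ring.
(* [M] makes the constants 1 - lambda_N and alpha M of the two cocoercive parts add up to 2 (1 -
   alpha mu). The stepsize condition then says exactly that M > L - mu, which gives M > 0 even when
   L = mu. *)
pose M := (1 + lam`_(N.-1)) / alpha - 2 * mu.
have ML : L - mu < M.
  rewrite /M -subr_gt0 -(pmulr_rgt0 _ alpha_gt0).
  rewrite (_ : alpha * _ = 1 + lam`_(N.-1) - alpha * (mu + L)) ?subr_gt0 //.
  by field; rewrite gt_eqF.
have M0 : 0 < M by apply: le_lt_trans ML; rewrite subr_ge0.
have hq : dot q q <= M * dot q u.
  rewrite !(dot_block q) mulr_sumr; apply: ler_sum => i _.
  rewrite /q /u !(blockD, blockN, blockZ) !block_stack.
  exact: (grad_cocoercive (f_diff i) (f_lip' i) (ltW L_gt0) mu_gt0 (f_conv i) _ _ M0 (ltW ML)).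
have : dot (a + alpha *: q) (a + alpha *: q) <=
    (1 - lam`_(N.-1) + alpha * M) * dot (a + alpha *: q) u.
  apply: cocoercive_add; rewrite ?subr_gt0 ?mulr_gt0 //.
    exact: kron_laplacian_cocoercive.
  rewrite !dotZl !dotZr -!mulrA ler_pM2l //.
  by rewrite [M * _]mulrC -mulrA ler_pM2l // mulrC.
have -> : 1 - lam`_(N.-1) + alpha * M = 2 * (1 - alpha * mu).
  by rewrite /M; field; rewrite gt_eqF.
(* In |(1 - alpha mu) u - s|^2 the cross term - 2 (1 - alpha mu) <s, u> absorbs |s|^2. *)
move: (a + alpha *: q) => s hs; clearbody u.
rewrite !dotE (dotC u s).
lra.
Qed.

(** The bound lambda_N > -1 is read off from the existence of a positive admissible stepsize. *)
Lemma gamma_lt1 : gamma_of lam < 1.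
Proof.
have lam1 := lam1_lt1 e_conn W_mix lam_eig N_gt1.
have lamN : -1 < lam`_(N.-1).
  have := alphaML; have : 0 < alpha * (mu + L) by rewrite mulr_gt0 // addr_gt0.
  lra.
have := lamN_le_lam1 lam_eig N_gt1; have := lamN_lt1.
by rewrite /gamma_of gt_max !ltr_norml; lra.
Qed.

Variable xinf : 'cV[R]_(N * d).
Hypothesis xinf_fixed :
  (1%:M - kron_id d W) *m xinf + alpha *: grad (sum_blocks f) xinf = 0.

Lemma laplacian_xinf :
  xinf - kron_id d W *m xinf = - (alpha *: stacked_grad xinf).
Proof.
move: xinf_fixed; rewrite mulmxBl mul1mx grad_sum_blocks // => /eqP.
by rewrite addr_eq0 => /eqP.
Qed.

Lemma dgd_step_xinf : dgd_step xinf = xinf.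
Proof.
by rewrite /dgd_step -laplacian_xinf addrC subrK.
Qed.

(* xinf minimizes the penalized objective <x, (I - W) x> / 2 + alpha F x,
   whose value at 0 is alpha F 0. *)
Lemma stacked_grad_xinf_le :
  dot (stacked_grad xinf) (stacked_grad xinf) <=
  2 * L * \sum_i (f i 0 - min_value (f i)).
Proof.
(* By the fixed point equation - alpha <grad F xinf, xinf> = <A xinf, xinf>, and cocoercivity makes
   A positive semidefinite. *)
have hG : dot (stacked_grad xinf) xinf <= 0.
  rewrite -oppr_ge0 -dotNl -(pmulr_rge0 _ alpha_gt0) -dotZl scalerN.
  rewrite -laplacian_xinf.
  have := kron_laplacian_cocoercive xinf.
  move=> /(le_trans (dot_ge0 _)); rewrite pmulr_rge0 ?subr_gt0 //.
apply: (@le_trans _ _ (2 * L * \sum_i (f i (block i xinf) - min_value (f i)))).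
  rewrite dot_block mulr_sumr; apply: ler_sum => i _; rewrite block_stack.
  exact: (grad_sqr_le_gap (f_diff i) (f_lip' i) (ltW L_gt0) mu_gt0 (f_conv i)).
rewrite ler_pM2l ?mulr_gt0 // !sumrB lerB //.
apply: (@le_trans _ _ (\sum_i (f i 0 + dot (grad (f i) (block i xinf)) (block i xinf)))).
  apply: ler_sum => i _.
  have := strong_convexity_gradient (f_diff i) (f_lip' i) (ltW L_gt0) mu_gt0
    (f_conv i) (block i xinf) (- block i xinf).
  rewrite subrr dotNr => h; have := dot_ge0 (- block i xinf).
  move=> /(mulr_ge0 (ltW (divr_gt0 mu_gt0 (ltr0Sn R 1)))); lra.
rewrite big_split /= gerDl; apply: le_trans hG.
by rewrite dot_block; apply: ler_sum => i _; rewrite block_stack.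
Qed.

Variable xstar : 'cV[R]_d.
Hypothesis xstar_min : forall y, average f xstar <= average f y.

Let one : 'cV[R]_N := const_mx 1.

Let mean : 'cV[R]_d := N%:R^-1 *: \sum_i block i xinf.

Let dev := xinf - stack (fun _ => mean).

Let N_gt0 : (0 : R) < N%:R. Proof. by rewrite ltr0n ltnW. Qed.

Let dot_one_W (u : 'cV[R]_N) : dot one (W *m u) = dot one u.
Proof.
have [_ [_ [_ Wc]] _ _] := W_mix.
rewrite /dot; under eq_bigr do rewrite !mxE mul1r.
rewrite exchange_big; apply: eq_bigr => j _.
by rewrite -mulr_suml Wc !mxE.
Qed.

Let coords_dev j : dot one (coords j dev) = 0.
Proof.
rewrite /dev coordsD coordsN dotDr dotNr /dot.
under eq_bigr do rewrite !mxE mul1r.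
under [X in _ - X]eq_bigr do rewrite !mxE mxtens_indexK mul1r ?mxE ?summxE /=.
rewrite sumr_const card_ord -[X in _ - X]mulr_natl mulrA mulfV ?gt_eqF // mul1r.
by rewrite -sumrB big1 // => i _; rewrite mxE subrr.
Qed.

(** Unit column sums make the range of I - W orthogonal to the constants, and the fixed point
    equation puts grad F xinf in that range. *)
Let sum_grad_xinf : \sum_i grad (f i) (block i xinf) = 0.
Proof.
apply/colP => j; rewrite summxE mxE.
have : dot one (coords j (xinf - kron_id d W *m xinf)) = 0.
  by rewrite coordsD coordsN coords_kron dotDr dotNr dot_one_W subrr.
rewrite laplacian_xinf -scaleNr coordsZ dotZr => /eqP.
rewrite mulf_eq0 oppr_eq0 gt_eqF //= => /eqP h; rewrite -[RHS]h.
by apply: eq_bigr => i _; rewrite !mxE mxtens_indexK /= ?mxE ?mul1r.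
Qed.

(** Consensus vectors lie in the kernel of A, so A dev = A xinf = - alpha grad F xinf, and the
    spectral gap applies to [dev], whose slices are orthogonal to the constants. *)
Lemma dev_le : (1 - lam`_1) ^+ 2 * dot dev dev <=
  alpha ^+ 2 * dot (stacked_grad xinf) (stacked_grad xinf).
Proof.
have -> : alpha ^+ 2 * dot (stacked_grad xinf) (stacked_grad xinf) =
    dot (xinf - kron_id d W *m xinf) (xinf - kron_id d W *m xinf).
  by rewrite laplacian_xinf dotNl dotNr opprK dotZl dotZr mulrA expr2.
have -> : xinf - kron_id d W *m xinf = dev - kron_id d W *m dev.
  rewrite /dev mulmxBr.
  have -> : kron_id d W *m stack (fun _ => mean) = stack (fun _ => mean).
    apply/colP => k; case: (mxtens_indexP k) => i j {k}.
    have /colP/(_ i) := coords_kron j W (stack (fun _ => mean)).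
    rewrite mxE => ->; rewrite !mxE mxtens_indexK /=.
    under eq_bigr do rewrite mxE mxE mxtens_indexK /=.
    by rewrite -mulr_suml (mixing_sum1 W_mix) mul1r /mean mxE.
  by rewrite opprB addrA subrK.
rewrite !dot_coords mulr_sumr; apply: ler_sum => j _.
rewrite coordsD coordsN coords_kron.
exact: (laplacian_gap e_conn W_mix lam_eig N_gt1).
Qed.

Lemma mean_xstar_le :
  N%:R * dot (mean - xstar) (mean - xstar) <= 4 * (L / mu) ^+ 2 * dot dev dev.
Proof.
set v := mean - xstar.
have h1 : \sum_i f i xstar <= \sum_i f i mean.
  by have := xstar_min mean; rewrite ler_pM2l ?invr_gt0.
(* The gradient at the mean is split around the gradient at block i of xinf, whose sum over i
   vanishes. *)
have h2 i : f i mean - dot (grad (f i) mean - grad (f i) (block i xinf)) v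
    - dot (grad (f i) (block i xinf)) v + mu / 2 * dot v v <= f i xstar.
  have := strong_convexity_gradient (f_diff i) (f_lip' i) (ltW L_gt0) mu_gt0
    (f_conv i) mean (- v).
  rewrite (_ : mean - v = xstar); last by rewrite /v opprB addrC subrK.
  by rewrite !dotNr !dotNl opprK => h; rewrite (dotDl _ (- _) v) dotNl; lra.
(* Young's inequality is weighted so that half of the term mu/2 |v|^2 survives; the factor 4 (L /
   mu)^2 is (L^2 / mu) divided by the remaining mu/4. *)
have h3 i : dot (grad (f i) mean - grad (f i) (block i xinf)) v <=
    mu / 4 * dot v v + L ^+ 2 / mu * dot (block i dev) (block i dev).
  set w := _ - _; have hw : dot w w <= L ^+ 2 * dot (block i dev) (block i dev).
    have L0 := ltW L_gt0.
    rewrite -!enorm_sqr -exprMn ler_sqr ?nnegrE ?mulr_ge0 ?enorm_ge0 //.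
    apply: le_trans (f_lip' i _ _) _; rewrite ler_pM2l //.
    apply: ler_enorm_sqr; rewrite /dev blockD blockN block_stack -opprB.
    by rewrite dotNl dotNr opprK.
  have hy := dot_ge0 (mu / 2 *: v - w).
  rewrite -(ler_pM2l mu_gt0).
  clearbody v w; rewrite !dotE (dotC w v) in hy; rewrite (dotC w v).
  have -> : mu * (mu / 4 * dot v v + L ^+ 2 / mu * dot (block i dev) (block i dev))
    = mu / 2 * (mu / 2 * dot v v) + L ^+ 2 * dot (block i dev) (block i dev).
    by field; rewrite gt_eqF.
  lra.
have : \sum_i (f i mean - (mu / 4 * dot v v + L ^+ 2 / mu * dot (block i dev) (block i dev))
    - dot (grad (f i) (block i xinf)) v + mu / 2 * dot v v) <= \sum_i f i xstar.
  by apply: ler_sum => i _; have := h2 i; have := h3 i; lra.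
rewrite !(big_split, sumrN) /= -dot_sum_l sum_grad_xinf dot0l.
rewrite -[\sum_i _ * dot (block i dev) _]mulr_sumr -(dot_block dev dev).
have sc (c : R) : \sum_(i < N) c = N%:R * c by rewrite sumr_const card_ord mulr_natl.
rewrite !sc => h4.
have h5 : mu / 4 * (N%:R * dot v v) <= L ^+ 2 / mu * dot dev dev by lra.
rewrite -(ler_pM2l (_ : 0 < mu / 4)) ?divr_gt0 //.
apply: (le_trans h5); rewrite le_eqVlt; apply/orP; left; apply/eqP.
by field; rewrite gt_eqF.
Qed.

Lemma xinf_xstar_le :
  enorm (xinf - stack (fun _ => xstar)) ^+ 2 <=
  alpha ^+ 2 * C1_of mu L f ^+ 2 * N%:R / (1 - gamma_of lam) ^+ 2.
Proof.
have -> : xinf - stack (fun _ => xstar) = dev + stack (fun _ => mean - xstar).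
  by apply/colP => k; rewrite !mxE; ring.
(* Deviation and consensus vectors are orthogonal, so the squared distance splits by Pythagoras. *)
have orth (v : 'cV[R]_d) : dot dev (stack (fun _ => v)) = 0.
  rewrite dot_coords big1 // => j _.
  have -> : coords j (stack (fun _ => v)) = v j 0 *: one.
    by apply/colP => i; rewrite !mxE mxtens_indexK mulr1.
  by rewrite dotZr dotC coords_dev mulr0.
rewrite enorm_sqr; have -> (a b : 'cV[R]_(N * d)) : dot (a + b) (a + b) =
    dot a a + 2 * dot a b + dot b b by rewrite !dotE (dotC b a); ring.
rewrite orth mulr0 addr0.
rewrite [X in _ + X]dot_block; under eq_bigr do rewrite block_stack.
rewrite sumr_const card_ord -[_ *+ N]mulr_natl.
set Q := 2 * L * \sum_i (f i 0 - min_value (f i)).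
have Q0 : 0 <= Q := le_trans (dot_ge0 _) stacked_grad_xinf_le.
have g1 : 0 < 1 - gamma_of lam by rewrite subr_gt0 gamma_lt1.
rewrite /C1_of exprMn sqr_sqrtr // ler_pdivlMr ?exprn_gt0 //.
have r0 : 0 <= L / mu by rewrite divr_ge0 ?ltW.
(* The left side collects the coefficients of |dev|^2 from both parts; the right side is the square
   of the second factor of [C1_of], that is, of 3 + 2 L / mu. *)
have hC : 1 + 4 * (L / mu) ^+ 2 <= (1 + 2 * (L + mu) / mu) ^+ 2.
  have -> : 2 * (L + mu) / mu = 2 * (L / mu) + 2 by field; rewrite gt_eqF.
  nra.
have hg : (1 - gamma_of lam) ^+ 2 <= (1 - lam`_1) ^+ 2.
  have : lam`_1 <= gamma_of lam by rewrite /gamma_of le_max ler_norm.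
  by move=> h; rewrite ler_sqr ?nnegrE ?lerB // ?ltW // (lt_le_trans g1) // lerB.
have hd : (1 - gamma_of lam) ^+ 2 * dot dev dev <= alpha ^+ 2 * Q.
  apply: le_trans (ler_wpM2r (dot_ge0 _) hg) _; apply: (le_trans dev_le).
  by rewrite ler_pM2l ?exprn_gt0 // stacked_grad_xinf_le.
have hN : 1 <= N%:R :> R by rewrite ler1n ltnW.
set C := (1 + _) ^+ 2 in hC *.
have h1 : dot dev dev + N%:R * dot (mean - xstar) (mean - xstar) <= C * dot dev dev.
  have := mean_xstar_le; have := ler_wpM2r (dot_ge0 dev) hC; lra.
have C0 : 0 <= C by rewrite sqr_ge0.
apply: le_trans (ler_wpM2r (sqr_ge0 _) h1) _.
rewrite mulrAC -mulrA.
apply: (@le_trans _ _ (C * (alpha ^+ 2 * Q))); first by rewrite ler_wpM2l // mulrC.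
have -> : alpha ^+ 2 * (Q * C) * N%:R = C * (alpha ^+ 2 * Q) * N%:R by ring.
by apply: ler_peMr => //; apply: mulr_ge0 => //; apply: mulr_ge0 => //; exact: sqr_ge0.
Qed.

End dgd.

(** * Integration against an independent noise *)

Section independent_pair.
Context {dT dU dE : measure_display} {T : measurableType dT}
  {U : measurableType dU} {E : measurableType dE} {R : realType}.
Variables (P : probability T R) (X : {mfun T >-> U}) (w : {mfun T >-> E}).
Hypothesis indep : forall A B, measurable A -> measurable B ->
  P (X @^-1` A `&` w @^-1` B) = (P (X @^-1` A) * P (w @^-1` B))%E.

Let PX : probability U R := distribution P X.
Let Pw : probability E R := distribution P w.

Let mpair : measurable_fun setT (fun t => (X t, w t)).
Proof. exact: measurable_fun_pair. Qed.

Let pair : {mfun T >-> (U * E)%type} :=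
  HB.pack_for {mfun T >-> (U * E)%type} (fun t => (X t, w t))
    (isMeasurableFun.Build _ _ T (U * E)%type _ mpair).

Let Ppair : probability (U * E)%type R := distribution P pair.

(** Independence is the product formula on rectangles, and these determine the product measure. *)
Let pair_law A : measurable A -> (PX \x Pw)%E A = Ppair A.
Proof.
move=> mA; by apply: product_measure_unique => // B C mB mC; exact: indep.
Qed.

Section integrable.
Variable K : U * E -> \bar R.
Hypothesis mK : measurable_fun [set: (U * E)%type] K.
Hypothesis intK : P.-integrable setT (fun t => K (X t, w t)).

Lemma integrable_product_law : (PX \x Pw)%E.-integrable setT K.
Proof.
have : Ppair.-integrable setT K by exact: integrable_pushforward.
move=> /integrableP[_ h]; apply/integrableP; split => //.
rewrite (@eq_measure_integral _ _ _ _ Ppair) // => A mA _; exact: pair_law.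
Qed.

Lemma integral_product_law :
  (\int[P]_t K (X t, w t) = \int[PX]_u \int[Pw]_e K (u, e))%E.
Proof.
transitivity (\int[PX \x Pw]_z K z)%E; last first.
  by rewrite -integral12_prod_meas1 //; exact: integrable_product_law.
rewrite (@eq_measure_integral _ _ _ _ Ppair) => [|A mA _]; last exact: pair_law.
by rewrite integral_distribution.
Qed.

End integrable.
End independent_pair.

Section freezing.
Context {dT dU dV dE : measure_display} {T : measurableType dT}
  {U : measurableType dU} {V : measurableType dV} {E : measurableType dE}
  {R : realType}.
Variables (P : probability T R) (X : {mfun T >-> U}) (Y : {mfun T >-> V})
  (w : {mfun T >-> E}) (p : U -> V).
Hypothesis mp : measurable_fun setT p.
Hypothesis YE : forall t, Y t = p (X t).
Hypothesis indep : forall A B, measurable A -> measurable B ->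
  P (X @^-1` A `&` w @^-1` B) = (P (X @^-1` A) * P (w @^-1` B))%E.
Variable H : V * E -> R.
Hypothesis mH : measurable_fun [set: (V * E)%type] H.
Hypothesis intH : P.-integrable setT (fun t => (H (Y t, w t))%:E).
Hypothesis H_centered : forall A, measurable A ->
  (\int[P]_(t in Y @^-1` A) (H (Y t, w t))%:E = 0)%E.

Let PX : probability U R := distribution P X.
Let PY : probability V R := distribution P Y.
Let Pw : probability E R := distribution P w.

Let indepY A B : measurable A -> measurable B ->
  P (Y @^-1` A `&` w @^-1` B) = (P (Y @^-1` A) * P (w @^-1` B))%E.
Proof.
move=> mA mB.
have YX : Y @^-1` A = X @^-1` (p @^-1` A) by apply/seteqP; split=> t /=; rewrite YE.
by rewrite YX indep // -[X in measurable X]setTI; exact: mp.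
Qed.

Let h v : \bar R := (\int[Pw]_e (H (v, e))%:E)%E.

Let intHp : (PY \x Pw)%E.-integrable setT (EFin \o H).
Proof. by apply: integrable_product_law => //; exact/measurable_EFinP. Qed.

(** By Fubini, the integral of [h] over A under the law of Y is the integral of H(Y, w) over the
    event that Y is in A, which is 0 for every measurable A. *)
Let h_eq0 : ae_eq PY setT h (cst 0%E).
Proof.
apply: integral_ae_eq => //; first exact: (integrable_fubini_F intHp).
move=> A _ mA; rewrite integral0 -(H_centered mA).
rewrite [LHS]integral_mkcond [RHS]integral_mkcond.
pose K (z : V * E) := ((H z)%:E * (\1_A z.1)%:E)%E.
have KE t : ((fun t => (H (Y t, w t))%:E) \_ (Y @^-1` A)) t = K (Y t, w t).
  rewrite patchE /K /= indicE.
  have -> : (t \in Y @^-1` A) = (Y t \in A) by apply/idP/idP; rewrite !inE.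
  by case: ifP; rewrite ?mule1 ?mule0.
under [RHS]eq_integral do rewrite KE.
have mK : measurable_fun setT K.
  apply: emeasurable_funM; first exact/measurable_EFinP.
  apply/measurable_EFinP; apply: measurableT_comp => //.
rewrite (integral_product_law indepY mK).
  apply: eq_integral => v _; rewrite patchE /K /= /h indicE.
  case: ifP => _; first by apply: eq_integral => e _; rewrite mule1.
  by rewrite [RHS](eq_integral (cst 0%E)) ?integral0 // => e _; rewrite mule0.
have -> : (fun t => K (Y t, w t)) = (fun t => (H (Y t, w t))%:E) \_ (Y @^-1` A).
  by apply/funext => t; rewrite KE.
have mYA : measurable (Y @^-1` A).
  by rewrite -[X in measurable X]setTI; exact: measurable_funP.
by apply/(integrable_mkcond _ _).1 => //; exact: (integrableS measurableT).
Qed.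

(** With X frozen at u, integrating over the independent w leaves phi(u) h(p u), and h vanishes
    almost everywhere. Thus centering given the coarser Y = p(X) extends to centering given X. *)
Lemma expectation_frozen (phi : U -> R) : measurable_fun setT phi ->
  P.-integrable setT (fun t => (phi (X t) * H (Y t, w t))%:E) ->
  (\int[P]_t (phi (X t) * H (Y t, w t))%:E = 0)%E.
Proof.
move=> mphi intphi.
pose K (z : U * E) := (phi z.1 * H (p z.1, z.2))%:E.
have KE t : (phi (X t) * H (Y t, w t))%:E = K (X t, w t) by rewrite /K /= YE.
under eq_integral do rewrite KE.
have mK : measurable_fun setT K.
  apply/measurable_EFinP; apply: measurable_funM.
    exact: measurableT_comp.
  apply: (measurableT_comp mH); apply: measurable_fun_pair => //.
  exact: measurableT_comp.
have intK : P.-integrable setT (fun t => K (X t, w t)).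
  by under eq_fun do rewrite -KE.
rewrite (integral_product_law indep mK) //.
(* Outside a null set h v = 0 and the section of H at v is integrable; the latter allows phi to
   leave the inner integral. The null set is then pulled back along p. *)
have [N [mN N0 hN]] : {ae PY, forall v,
    h v = 0%E /\ Pw.-integrable setT (fun e => (H (v, e))%:E)}.
  have := ae_integrable1 intHp; have := h_eq0.
  by apply: filterS2 => v hv iv; split; first exact: hv.
rewrite (ae_eq_integral (cst 0%E)) ?integral0 //.
  exact: measurable_int (integrable_fubini_F (integrable_product_law indep mK intK)).
exists (p @^-1` N); split.
- by rewrite -[X in measurable X]setTI; exact: mp.
- rewrite -[RHS]N0 /PX /PY /distribution /pushforward.
  by congr (P _); apply/seteqP; split=> t /=; rewrite YE.
- move=> u /= hu; apply: hN => /= -[h0 hi]; apply: hu => _.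
  under eq_integral do rewrite /K /= EFinM.
  by rewrite integralZl // -/(h (p u)) h0 mule0.
Qed.

End freezing.

(** * Mean square recursion *)

Section borel_columns.
Context {R : realType} {dU : measure_display} {U : measurableType dU} {n : nat}.

Lemma borelcV_coord (i : 'I_n) :
  measurable_fun setT (fun x : borelcV R n => (x : 'cV[R]_n) i 0).
Proof.
move=> _ B mB; apply: sub_sigma_algebra; exists i => //.
by exists B.
Qed.

Lemma measurable_borelcV (X : U -> borelcV R n) :
  (forall i, measurable_fun setT (fun t => (X t : 'cV[R]_n) i 0)) ->
  measurable_fun setT X.
Proof.
move=> mX; apply: (@measurability _ _ U (borelcV R n) setT X
  (\bigcup_(i in [set: 'I_n])
    preimage_set_system setT (fun x : 'cV[R]_n => x i 0) measurable)) => //.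
move=> _ [B [i _ [C mC <-]] <-].
have := mX i measurableT C mC.
by rewrite !setTI.
Qed.

End borel_columns.

(** The source space is arbitrary and only the noise before step k is assumed measurable, so that
    the lemma applies to the ambient sigma-algebra and to the one generated by the past alike. *)
Lemma measurable_dsg (dU dE : measure_display) (U : measurableType dU)
    (E : measurableType dE) (R : realType) (N d : nat) (W : 'M[R]_N) (alpha : R)
    (g : 'I_N -> 'cV[R]_d -> E -> 'cV[R]_d) (w : nat -> 'I_N -> U -> E) x0 k :
  (forall i, measurable_fun setT
    (fun p : borelcV R d * E => g i p.1 p.2 : borelcV R d)) ->
  (forall m i, (m < k)%N -> measurable_fun setT (w m i)) ->
  measurable_fun setT (dsg W alpha g w x0 k : U -> borelcV R (N * d)).
Proof.
move=> mg; elim: k => [|k IH] mw /=; first exact: measurable_cst.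
have mx : measurable_fun setT (dsg W alpha g w x0 k : U -> borelcV R (N * d)).
  by apply: IH => m i mk; apply: mw; exact: ltnW.
apply: measurable_borelcV => l.
have -> : (fun t => (kron_id d W *m dsg W alpha g w x0 k t - alpha *:
     stack (fun i => g i (block i (dsg W alpha g w x0 k t)) (w k i t))) l 0) =
  (fun t => \sum_m (kron_id d W l m * dsg W alpha g w x0 k t m 0)
     - alpha * g (mxtens_unindex l).1 (block (mxtens_unindex l).1 (dsg W alpha g w x0 k t))
         (w k (mxtens_unindex l).1 t) (mxtens_unindex l).2 0).
  by apply/funext => t; rewrite !mxE.
apply: measurable_funB.
  apply: measurable_sum => m; apply: measurable_funM; first exact: measurable_cst.
  exact: (measurableT_comp (borelcV_coord m) mx).
apply: measurable_funM; first exact: measurable_cst.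
set i := (mxtens_unindex l).1; set j := (mxtens_unindex l).2.
apply: (measurableT_comp (borelcV_coord j)).
apply: (measurableT_comp (mg i)
  (g := fun t => (block i (dsg W alpha g w x0 k t) : borelcV R d, w k i t))).
apply: measurable_fun_pair; last exact: mw.
apply: measurable_borelcV => j'.
under eq_fun do rewrite mxE.
exact: (measurableT_comp (borelcV_coord _) mx).
Qed.

Section real_integrals.
Context {dT : measure_display} {T : measurableType dT} {R : realType}.
Variable P : probability T R.
Implicit Types f h : T -> R.

Definition rintegrable f := P.-integrable setT (fun t => (f t)%:E).

Lemma rintegrableD f h : rintegrable f -> rintegrable h ->
  rintegrable (fun t => f t + h t).
Proof. by move=> fi hi; exact: (integrableD measurableT fi hi). Qed.

Lemma rintegralD f h : rintegrable f -> rintegrable h ->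
  (\int[P]_t (f t + h t)%:E = \int[P]_t (f t)%:E + \int[P]_t (h t)%:E)%E.
Proof. by move=> fi hi; rewrite -integralD. Qed.

Lemma rintegrableZ c f : rintegrable f -> rintegrable (fun t => c * f t).
Proof. by move=> fi; exact: (integrableZl measurableT c fi). Qed.

Lemma rintegralZ c f : rintegrable f ->
  (\int[P]_t (c * f t)%:E = c%:E * \int[P]_t (f t)%:E)%E.
Proof. by move=> fi; rewrite -integralZl. Qed.

Lemma rintegrable_sum (I : finType) (F : I -> T -> R) :
  (forall i, rintegrable (F i)) -> rintegrable (fun t => \sum_i F i t).
Proof.
move=> Fi; rewrite /rintegrable; under eq_fun do rewrite -sumEFin.
by apply: integrable_sum => // i _; exact: Fi.
Qed.

Lemma rintegral_sum (I : finType) (F : I -> T -> R) :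
  (forall i, rintegrable (F i)) ->
  (\int[P]_t (\sum_i F i t)%:E = \sum_i \int[P]_t (F i t)%:E)%E.
Proof.
move=> Fi; under eq_integral do rewrite -sumEFin.
by rewrite integral_sum // => i _; exact: Fi.
Qed.

Lemma rintegrable_cst c : rintegrable (fun=> c).
Proof. exact: finite_measure_integrable_cst. Qed.

Lemma rintegral_cst c : (\int[P]_t (c%:E) = c%:E)%E.
Proof. by have := expectation_cst P c; rewrite unlock. Qed.

Lemma rintegrable_le f h : measurable_fun setT f -> (forall t, `|f t| <= h t) ->
  rintegrable h -> rintegrable f.
Proof.
move=> mf fh; apply: le_integrable => //; first exact/measurable_EFinP.
by move=> t _; rewrite !abse_EFin lee_fin (le_trans (fh t)) // ler_norm.
Qed.

Lemma rintegral_le f h : rintegrable f -> rintegrable h ->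
  (forall t, f t <= h t) -> (\int[P]_t (f t)%:E <= \int[P]_t (h t)%:E)%E.
Proof. by move=> fi hi fh; apply: le_integral => // t _; rewrite lee_fin. Qed.

End real_integrals.

Section oracle.
Context {R : realType} {N d : nat} {dT dE : measure_display}
  {T : measurableType dT} {E : measurableType dE}.
Variables (f : 'I_N -> 'cV[R]_d -> R) (W : 'M[R]_N) (alpha : R)
  (P : probability T R) (g : 'I_N -> 'cV[R]_d -> E -> 'cV[R]_d).
Hypothesis mg : forall i, measurable_fun setT
  (fun p : borelcV R d * E => g i p.1 p.2 : borelcV R d).
Variable w : nat -> 'I_N -> T -> E.
Hypothesis mw : forall k i, measurable_fun setT (w k i).
Hypothesis w_indep : noise_independent P w.
Variables (x0 : 'cV[R]_(N * d)) (sigma : R).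
Let x := dsg W alpha g w x0.
Hypothesis unbiased : unbiased_oracle P f g w x.
Hypothesis bounded_var : bounded_oracle_variance P sigma f g w x.

Definition past k i : set_system T :=
  \bigcup_(a in [set a : nat * 'I_N | (a.1 < k)%N \/ (a.1 = k /\ a.2 <> i)])
    sigma_of (w a.1 a.2).

(** The same set T under a smaller sigma-algebra: measurability with respect to the past becomes
    plain measurability on this space, and the past becomes a random variable, namely the
    identity. *)
Let TF k i := g_sigma_algebraType (past k i).

Let block_sys k i := sigma_of (fun t => block i (x k t) : borelcV R d).

Let TG k i := g_sigma_algebraType (block_sys k i).

Let xi k i j t :=
  g i (block i (x k t)) (w k i t) j 0 - grad (f i) (block i (x k t)) j 0.

Lemma measurable_past k i : measurable_fun [set: T] (idfun : T -> TF k i).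
Proof.
apply: (@measurability _ _ T (TF k i) setT idfun (past k i)) => //.
move=> _ [A [a _ [B mB <-]] <-].
by rewrite !setTI; have := mw a.1 a.2 measurableT mB; rewrite setTI.
Qed.

Lemma measurable_w_past k i m j : (m < k)%N ->
  measurable_fun [set: TF k i] (w m j : TF k i -> E).
Proof.
move=> mk _ B mB; apply: sub_sigma_algebra; exists (m, j) => /=; first by left.
by exists B.
Qed.

Lemma measurable_x_past k i :
  measurable_fun [set: TF k i] (x k : TF k i -> borelcV R (N * d)).
Proof.
exact: (measurable_dsg (U := TF k i) _ _ _ mg (fun m j => @measurable_w_past k i m j)).
Qed.

Lemma measurable_block k i : measurable_fun [set: TG k i]
  (fun t => block i (x k t) : borelcV R d).
Proof. by move=> _ B mB; apply: sub_sigma_algebra; exists B. Qed.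

Lemma measurable_block_past k i i' :
  measurable_fun [set: TF k i] (fun t => block i' (x k t) : borelcV R d).
Proof.
apply: measurable_borelcV => j; under eq_fun do rewrite mxE.
exact: (measurableT_comp (borelcV_coord _) (@measurable_x_past k i)).
Qed.

(** Preimages of a sigma-algebra already form one, so generation adds no set. *)
Lemma block_sysE k i A : @measurable _ (TG k i) A -> block_sys k i A.
Proof.
rewrite /measurable /= sigma_algebra_id //.
apply: sigma_algebra_preimage; exact: sigma_algebra_measurable.
Qed.

Lemma measurable_block_sys_past k i i' :
  measurable_fun [set: TF k i] (idfun : TF k i -> TG k i').
Proof.
move=> _ A /block_sysE[B mB <-]; rewrite !setTI.
by have := @measurable_block_past k i i' measurableT _ mB; rewrite setTI.
Qed.

(** The gradient is a version of a conditional expectation given the i-th block, and measurability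
    is part of being one. *)
Lemma measurable_grad k i j : measurable_fun [set: TG k i]
  (fun t => grad (f i) (block i (x k t)) j 0).
Proof.
have [_ _ h _] := unbiased k i j.
by move=> _ B mB; rewrite setTI; apply: sub_sigma_algebra; exact: h.
Qed.

Lemma measurable_grad_past k i i' j : measurable_fun [set: TF k i]
  (fun t => grad (f i') (block i' (x k t)) j 0).
Proof.
exact: (measurableT_comp (@measurable_grad k i' j)
  (@measurable_block_sys_past k i i')).
Qed.

Lemma rintegrable_xi k i j : rintegrable P (xi k i j).
Proof. by have [gi gri _ _] := unbiased k i j; exact: (integrableB measurableT gi gri). Qed.

(** [expectation_frozen] applies with X the past, Y the coarser sigma-algebra of the i-th block, and
    H the oracle error as a function of Y and of the fresh noise. *)
Lemma noise_orthogonal k i j (phi : T -> R) :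
  measurable_fun [set: TF k i] (phi : TF k i -> R) ->
  rintegrable P (fun t => phi t * xi k i j t) ->
  (\int[P]_t (phi t * xi k i j t)%:E = 0)%E.
Proof.
move=> mphi iphi.
pose X : {mfun T >-> TF k i} := HB.pack_for {mfun T >-> TF k i} (idfun : T -> TF k i)
    (isMeasurableFun.Build _ _ T (TF k i) _ (@measurable_past k i)).
have mY : measurable_fun [set: T] (idfun : T -> TG k i).
  exact: (measurableT_comp (@measurable_block_sys_past k i i) (@measurable_past k i)).
pose Y : {mfun T >-> TG k i} := HB.pack_for {mfun T >-> TG k i} (idfun : T -> TG k i)
    (isMeasurableFun.Build _ _ T (TG k i) _ mY).
pose v : {mfun T >-> E} := HB.pack_for {mfun T >-> E} (w k i)
    (isMeasurableFun.Build _ _ T E _ (mw k i)).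
pose H (z : TG k i * E) : R := g i (block i (x k z.1)) z.2 j 0
  - grad (f i) (block i (x k z.1)) j 0.
have mH : measurable_fun [set: (TG k i * E)%type] H.
  apply: measurable_funB.
    apply: (measurableT_comp (borelcV_coord j)).
    apply: (measurableT_comp (mg i)
      (g := fun z : TG k i * E => (block i (x k z.1) : borelcV R d, z.2))).
    apply: measurable_fun_pair => //.
    exact: (measurableT_comp (@measurable_block k i)).
  exact: (measurableT_comp (@measurable_grad k i j)).
apply: (@expectation_frozen _ _ _ _ T (TF k i) (TG k i) E R P X Y v idfun
  (@measurable_block_sys_past k i i) _ _ H mH _ _ phi mphi iphi) => //.
- move=> A B mA mB; rewrite setIC muleC; apply: w_indep; last exact: mA.
  by exists B => //; rewrite setTI.
- exact: rintegrable_xi.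
- move=> A mA; have [gi gri _ h] := unbiased k i j.
  have mA' : @measurable _ T A.
    by have := mY measurableT _ mA; rewrite setTI.
  have giA := integrableS measurableT mA' (@subsetT _ A) gi.
  have griA := integrableS measurableT mA' (@subsetT _ A) gri.
  have := integralB_EFin mA' giA griA.
  rewrite (h _ (block_sysE mA)) subee //.
  exact: integrable_fin_num griA.
Qed.

Lemma noise_variance k i :
  rintegrable P (fun t => \sum_j xi k i j t ^+ 2) /\
  (\int[P]_t (\sum_j xi k i j t ^+ 2)%:E <= (sigma ^+ 2)%:E)%E.
Proof.
have [V [[nint Vint _ VE] Vle]] := bounded_var k i.
have nE t : enorm (g i (block i (x k t)) (w k i t) - grad (f i) (block i (x k t))) ^+ 2
    = \sum_j xi k i j t ^+ 2.
  by rewrite enorm_sqr; apply: eq_bigr => j _; rewrite /xi !mxE expr2.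
split.
  by rewrite /rintegrable; under eq_fun do rewrite -nE.
under eq_integral do rewrite -nE.
rewrite (VE setT); last by exists setT; rewrite ?preimage_setT ?setTI.
rewrite -(rintegral_cst P (sigma ^+ 2)).
(* [V] is bounded only almost everywhere; truncating it at sigma^2 changes it on a null set and
   makes the bound hold pointwise. *)
have Vmin : rintegrable P (fun t => Num.min (V t) (sigma ^+ 2)).
  apply: (@rintegrable_le _ _ _ _ _ (fun t => `|V t| + sigma ^+ 2)).
  - apply: measurable_minr => //.
    by apply/measurable_EFinP; exact: measurable_int Vint.
  - move=> t; rewrite -[X in _ + X]ger0_norm ?sqr_ge0 // /Num.min.
    by case: ifP => _; rewrite ?lerDl ?lerDr.
  - by apply: rintegrableD; [exact: integrable_norm|exact: rintegrable_cst].
rewrite (ae_eq_integral (fun t => (Num.min (V t) (sigma ^+ 2))%:E)) //.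
- by apply: rintegral_le => // [|t]; [exact: rintegrable_cst|rewrite ge_min lexx orbT].
- exact: measurable_int Vint.
- exact: measurable_int Vmin.
- by move: Vle; apply: filterS => t Vt _; rewrite min_l.
Qed.

Variables (z : 'cV[R]_(N * d)) (r : R).
Let S := dgd_step f W alpha.
Hypothesis S_contr : forall y, dot (S y - z) (S y - z) <= r * dot (y - z) (y - z).

Let dist k t := dot (x k t - z) (x k t - z).

Let err k i j t := (S (x k t) - z) (mxtens_index (i, j)) 0.

Lemma measurable_x k : measurable_fun [set: T] (x k : T -> borelcV R (N * d)).
Proof. by apply: measurable_dsg. Qed.

Lemma measurable_dist k : measurable_fun [set: T] (dist k).
Proof.
apply: measurable_sum => m.
have h : measurable_fun [set: T] (fun t => (x k t - z) m 0).
  under eq_fun do rewrite !mxE.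
  apply: measurable_funB => //.
  exact: (measurableT_comp (borelcV_coord m) (measurable_x k)).
exact: measurable_funM.
Qed.

Lemma measurable_err_past k i i' j :
  measurable_fun [set: TF k i] (err k i' j : TF k i -> R).
Proof.
have -> : err k i' j = (fun t =>
    \sum_m (kron_id d W (mxtens_index (i', j)) m * x k t m 0)
    - alpha * grad (f i') (block i' (x k t)) j 0 - z (mxtens_index (i', j)) 0).
  apply/funext => t; rewrite /err /S /dgd_step.
  have <- : stacked_grad f (x k t) (mxtens_index (i', j)) 0
      = grad (f i') (block i' (x k t)) j 0 by rewrite mxE mxtens_indexK.
  by move: (stacked_grad f _) => G; rewrite !mxE.
apply: measurable_funB => //; apply: measurable_funB.
  apply: measurable_sum => m; apply: measurable_funM => //.
  exact: (measurableT_comp (borelcV_coord m) (@measurable_x_past k i)).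
by apply: measurable_funM => //; exact: measurable_grad_past.
Qed.

Lemma measurable_err k i j : measurable_fun [set: T] (err k i j).
Proof. exact: (measurableT_comp (@measurable_err_past k i i j) (@measurable_past k i)). Qed.

Lemma measurable_xi k i j : measurable_fun [set: T] (xi k i j).
Proof. by apply/measurable_EFinP; exact: measurable_int (rintegrable_xi k i j). Qed.

(** The next iterate is the noiseless step minus alpha times the oracle error; the square is
    expanded in coordinates so that the cross terms can be integrated one by one. *)
Lemma dist_succ k t : dist k.+1 t = \sum_i \sum_j err k i j t ^+ 2
  + (- (2 * alpha)) * \sum_i \sum_j err k i j t * xi k i j t
  + alpha ^+ 2 * \sum_i \sum_j xi k i j t ^+ 2.
Proof.
pose b := stack (fun i => g i (block i (x k t)) (w k i t) - grad (f i) (block i (x k t))).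
have bE i j : b (mxtens_index (i, j)) 0 = xi k i j t.
  by rewrite /b mxE mxtens_indexK /xi !mxE.
have -> : dist k.+1 t = dot (S (x k t) - z - alpha *: b) (S (x k t) - z - alpha *: b).
  rewrite /dist; congr dot; rewrite /= -/x /S /dgd_step /stacked_grad /b;
  apply/colP => m; rewrite !mxE; ring.
have -> : \sum_i \sum_j err k i j t ^+ 2 = dot (S (x k t) - z) (S (x k t) - z).
  by rewrite /dot sum_mxtens; apply: eq_bigr => i _; apply: eq_bigr => j _;
    rewrite -expr2.
have -> : \sum_i \sum_j err k i j t * xi k i j t = dot (S (x k t) - z) b.
  by rewrite /dot sum_mxtens; apply: eq_bigr => i _; apply: eq_bigr => j _;
    rewrite bE.
have -> : \sum_i \sum_j xi k i j t ^+ 2 = dot b b.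
  by rewrite /dot sum_mxtens; apply: eq_bigr => i _; apply: eq_bigr => j _;
    rewrite bE expr2.
move: (S _ - z) => a; clear bE; clearbody b; rewrite !dotE (dotC b a); ring.
Qed.

Lemma dist_step k : rintegrable P (dist k) ->
  rintegrable P (dist k.+1) /\
  (\int[P]_t (dist k.+1 t)%:E <=
   r%:E * \int[P]_t (dist k t)%:E + (alpha ^+ 2 * (N%:R * sigma ^+ 2))%:E)%E.
Proof.
move=> idist.
have err_le t : \sum_i \sum_j err k i j t ^+ 2 <= r * dist k t.
  apply: le_trans (S_contr (x k t)); rewrite /dot sum_mxtens.
  by apply: ler_sum => i _; apply: ler_sum => j _; rewrite -expr2.
have irdist : rintegrable P (fun t => r * dist k t) by exact: rintegrableZ.
have ierr i j : rintegrable P (fun t => err k i j t ^+ 2).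
  apply: rintegrable_le irdist => [|t].
    by apply: measurable_funX; exact: measurable_err.
  rewrite ger0_norm ?sqr_ge0 //; apply: le_trans (err_le t).
  rewrite (bigD1 i) //= (bigD1 j) //= -addrA lerDl addr_ge0 //.
    by apply: sumr_ge0 => j' _; rewrite sqr_ge0.
  by apply: sumr_ge0 => i' _; apply: sumr_ge0 => j' _; rewrite sqr_ge0.
have ixi i j : rintegrable P (fun t => xi k i j t ^+ 2).
  have [h _] := noise_variance k i; apply: rintegrable_le h => [|t].
    by apply: measurable_funX; exact: measurable_xi.
  rewrite ger0_norm ?sqr_ge0 // (bigD1 j) //= lerDl.
  by apply: sumr_ge0 => j' _; rewrite sqr_ge0.
have iprod i j : rintegrable P (fun t => err k i j t * xi k i j t).
  apply: rintegrable_le (rintegrableD (ierr i j) (ixi i j)) => [|t].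
    by apply: measurable_funM; [exact: measurable_err|exact: measurable_xi].
  have := sqr_ge0 (err k i j t - xi k i j t).
  have := sqr_ge0 (err k i j t + xi k i j t).
  have := sqr_ge0 (err k i j t); have := sqr_ge0 (xi k i j t).
  by rewrite ler_norml !expr2; lra.
have isum (F : 'I_N -> 'I_d -> T -> R) : (forall i j, rintegrable P (F i j)) ->
    rintegrable P (fun t => \sum_i \sum_j F i j t).
  by move=> iF; apply: rintegrable_sum => i; exact: rintegrable_sum.
have ierrs := isum _ ierr; have ixis := isum _ ixi; have iprods := isum _ iprod.
have iprods' := rintegrableZ (- (2 * alpha)) iprods.
have ixis' := rintegrableZ (alpha ^+ 2) ixis.
have i2 := rintegrableD ierrs iprods'.
rewrite (funext (dist_succ k)); split; first exact: rintegrableD.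
rewrite rintegralD // rintegralD // !rintegralZ //.
(* Each coordinate of the noiseless step is determined by the past, hence orthogonal to the fresh
   error. *)
have -> : (\int[P]_t (\sum_i \sum_j err k i j t * xi k i j t)%:E = 0)%E.
  rewrite rintegral_sum => [|i]; last exact: rintegrable_sum.
  rewrite big1 // => i _; rewrite rintegral_sum // big1 // => j _.
  by apply: noise_orthogonal => //; exact: measurable_err_past.
rewrite mule0 adde0 (EFinM (alpha ^+ 2) (N%:R * _)); apply: leeD.
  by rewrite -rintegralZ //; exact: rintegral_le.
apply: lee_wpmul2l; first by rewrite lee_fin sqr_ge0.
rewrite rintegral_sum => [|i]; last exact: rintegrable_sum.
have -> : (N%:R * sigma ^+ 2)%:E = (\sum_(i < N) (sigma ^+ 2)%:E)%E.
  by rewrite sumEFin sumr_const card_ord mulr_natl.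
by apply: lee_sum => i _; have [_] := noise_variance k i.
Qed.

Lemma dist_bound k : r != 1 -> 0 <= r ->
  rintegrable P (dist k) /\
  (\int[P]_t (dist k t)%:E <=
   (r ^+ k * dot (x0 - z) (x0 - z)
    + alpha ^+ 2 * (N%:R * sigma ^+ 2) * ((1 - r ^+ k) / (1 - r)))%:E)%E.
Proof.
move=> r1 r0; elim: k => [|k [IHi IH]].
  split; first exact: (rintegrable_cst P (dot (x0 - z) (x0 - z))).
  rewrite (rintegral_cst P (dot (x0 - z) (x0 - z))) lee_fin.
  by rewrite expr0 subrr mul0r mulr0 addr0 mul1r.
have [i1 h1] := dist_step IHi; split=> //; apply: (le_trans h1).
have r1' : 1 - r != 0 by rewrite subr_eq0 eq_sym.
apply: (@le_trans _ _ (r%:E * (r ^+ k * dot (x0 - z) (x0 - z)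
    + alpha ^+ 2 * (N%:R * sigma ^+ 2) * ((1 - r ^+ k) / (1 - r)))%:E +
    (alpha ^+ 2 * (N%:R * sigma ^+ 2))%:E)%E).
  by rewrite leeD2r // lee_wpmul2l // lee_fin.
rewrite -EFinM -EFinD lee_fin (exprS r) le_eqVlt; apply/orP; left; apply/eqP.
by move: (r ^+ k) => q; field.
Qed.

End oracle.

(** * Variance and limit superior *)

Section variance.
Context {R : realType} {dT : measure_display} {T : measurableType dT} {n : nat}.
Variables (P : probability T R) (X : T -> 'cV[R]_n) (c : 'cV[R]_n).
Hypothesis mX : forall i, measurable_fun setT (fun t => X t i 0).
Hypothesis iX : rintegrable P (fun t => dot (X t - c) (X t - c)).

(** The difference |X - m|^2 - |X - c|^2 is affine in X, and its expectation at the mean m is - |c -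
    m|^2. *)
Lemma vvar_le : (vvar P X <= \int[P]_t (dot (X t - c) (X t - c))%:E)%E.
Proof.
set m := vmean P X.
(* From |a| <= 1 + a^2. Integrability makes [vmean] the true mean, as [fine] would turn an infinite
   value into 0. *)
have iXi i : rintegrable P (fun t => X t i 0).
  apply: rintegrable_le (rintegrableD (rintegrable_cst P (1 + `|c i 0|)) iX) => // t.
  have : `|X t i 0 - c i 0| <= 1 + dot (X t - c) (X t - c).
    have : (X t i 0 - c i 0) ^+ 2 <= dot (X t - c) (X t - c).
      rewrite /dot (bigD1 i) //= !mxE -expr2 lerDl.
      by apply: sumr_ge0 => j _; rewrite -expr2 sqr_ge0.
    move: (X t i 0 - c i 0) => a h; have h1 := sqr_ge0 (`|a| - 1).
    rewrite -real_normK ?num_real // in h.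
    have := normr_ge0 a; rewrite sqrrB expr1n mulr1 mulr2n in h1; lra.
  have := ler_normD (X t i 0 - c i 0) (c i 0); rewrite subrK; lra.
have mE i : (\int[P]_t (X t i 0)%:E = (m i 0)%:E)%E.
  rewrite /m /vmean mxE unlock fineK //.
  exact: integrable_fin_num (iXi i).
have dE t : dot (X t - m) (X t - m) = dot (X t - c) (X t - c) +
    (\sum_i (2 * (c i 0 - m i 0)) * X t i 0 + (dot m m - dot c c)).
  rewrite /dot -sumrB -!big_split /=; apply: eq_bigr => i _.
  by rewrite !mxE; ring.
have isum : rintegrable P (fun t => \sum_i (2 * (c i 0 - m i 0)) * X t i 0).
  by apply: rintegrable_sum => i; exact: rintegrableZ.
have ic := rintegrable_cst P (dot m m - dot c c).
rewrite /vvar unlock; under eq_integral do rewrite enorm_sqr dE.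
rewrite rintegralD //; last exact: rintegrableD.
rewrite -[leRHS]adde0; apply: leeD2l.
rewrite rintegralD // rintegral_cst rintegral_sum => [|i]; last first.
  exact: rintegrableZ.
under eq_bigr do rewrite rintegralZ // mE -EFinM.
rewrite sumEFin -EFinD lee_fin.
have -> : \sum_i 2 * (c i 0 - m i 0) * m i 0 = 2 * (dot c m - dot m m).
  by rewrite /dot -sumrB mulr_sumr; apply: eq_bigr => i _; ring.
have := dot_ge0 (c - m); rewrite !dotE (dotC m c); lra.
Qed.

End variance.

Lemma limn_esup_le_lim (R : realType) (u : (\bar R)^nat) (a : R^nat) (l : R) :
  (forall k, u k <= (a k)%:E)%E -> a @ \oo --> l -> (limn_esup u <= l%:E)%E.
Proof.
move=> ua al.
have al' : (EFin \o a) @ \oo --> l%:E by apply: cvg_comp al _.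
rewrite limn_esup_lim -(cvg_lim _ (cvg_esups al')) //.
apply: lee_lim; [exact: is_cvg_esups|exact: is_cvg_esups|].
apply: nearW => k; apply: ge_ereal_sup => _ [m /= km <-].
apply: (le_trans (ua m)); apply: ereal_sup_ubound; by exists m.
Qed.

Theorem corollary2
  (R : realType) (N d : nat) (hN : (1 < N)%N)
  (mu L : R) (hmu : 0 < mu) (hmuL : mu <= L)
  (f : 'I_N -> 'cV[R]_d -> R)
  (hconv : forall i, strongly_convex mu (f i))
  (hlip : forall i, lipschitz_gradient L (f i))
  (xstar : 'cV[R]_d)
  (hxstar : forall y, average f xstar <= average f y)
  (e : rel 'I_N) (he : connected_graph e)
  (W : 'M[R]_N) (hW : mixing_matrix e W)
  (lam : N.-tuple R) (hlam : ordered_eigenvalues W lam)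
  (alpha : R) (halpha0 : 0 < alpha)
  (halpha : alpha < (1 + lam`_(N.-1)) / (mu + L))
  (xinf : 'cV[R]_(N * d))
  (hxinf : (1%:M - kron_id d W) *m xinf
           + alpha *: grad (sum_blocks f) xinf = 0)
  (dT dE : measure_display) (T : measurableType dT) (E : measurableType dE)
  (P : probability T R)
  (g : 'I_N -> 'cV[R]_d -> E -> 'cV[R]_d)
  (hg : forall i, measurable_fun setT
          (fun p : borelcV R d * E => g i p.1 p.2 : borelcV R d))
  (w : nat -> 'I_N -> T -> E)
  (hw : forall k i, measurable_fun setT (w k i))
  (hindep : noise_independent P w)
  (x0 : 'cV[R]_(N * d))
  (sigma : R) (hsigma : 0 <= sigma)
  (hunb : unbiased_oracle P f g w (dsg W alpha g w x0))
  (hvar : bounded_oracle_variance P sigma f g w (dsg W alpha g w x0)) :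
  [/\ forall k : nat,
        ('E_P[(fun t => enorm (dsg W alpha g w x0 k t - xinf) ^+ 2)%R] <=
         ((1 - alpha * mu) ^+ (2 * k) * enorm (x0 - xinf) ^+ 2
          + alpha * sigma ^+ 2 * N%:R
            * ((1 - (1 - alpha * mu) ^+ (2 * k))
               / (mu * (2 - alpha * mu))))%:E)%E,
      0 < sigma ->
        (J_infty P N sigma (dsg W alpha g w x0) <=
         (alpha / (mu * (2 - alpha * mu)))%:E)%E
    & alpha <= 1 / (L + mu) -> forall k : nat,
        ('E_P[(fun t => enorm (dsg W alpha g w x0 k t
                              - stack (fun _ : 'I_N => xstar)) ^+ 2)%R] <=
         (2 * (1 - alpha * mu) ^+ (2 * k) * enorm (x0 - xinf) ^+ 2
          + 2 * alpha * sigma ^+ 2 * N%:R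
            * ((1 - (1 - alpha * mu) ^+ (2 * k))
               / (mu * (2 - alpha * mu)))
          + 2 * alpha ^+ 2 * C1_of mu L f ^+ 2 * N%:R
            / (1 - gamma_of lam) ^+ 2)%:E)%E].
Proof.
pose x := dsg W alpha g w x0; rewrite -/x.
pose r : R := (1 - alpha * mu) ^+ 2.
have am0 : 0 < alpha * mu by rewrite mulr_gt0.
have am1 := alpha_mu_lt1 hmu hmuL hN he hW hlam halpha0 halpha.
have r0 : 0 <= r by rewrite sqr_ge0.
have r1 : r < 1 by rewrite /r; nra.
pose S := dgd_step f W alpha.
have S_contr y : dot (S y - xinf) (S y - xinf) <= r * dot (y - xinf) (y - xinf).
  rewrite -{1 2}(dgd_step_xinf hlip hxinf).
  exact: (dgd_step_contraction hmu hmuL hconv hlip hN he hW hlam halpha0 halpha).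
pose D := enorm (x0 - xinf) ^+ 2.
pose B k : R := (1 - alpha * mu) ^+ (2 * k) * D + alpha * sigma ^+ 2 * N%:R *
  ((1 - (1 - alpha * mu) ^+ (2 * k)) / (mu * (2 - alpha * mu))).
have bound k : rintegrable P (fun t => dot (x k t - xinf) (x k t - xinf)) /\
    (\int[P]_t (dot (x k t - xinf) (x k t - xinf))%:E <= (B k)%:E)%E.
  have [] := dist_bound hg hw hindep hunb hvar S_contr k (negbT (lt_eqF r1)) r0.
  move=> i h; split=> //; apply: (le_trans h); rewrite lee_fin /B /D enorm_sqr exprM -/r.
  rewrite lerD2l le_eqVlt; apply/orP; left; apply/eqP.
  (* One factor alpha of alpha^2 N sigma^2 / (1 - r) cancels here, which gives the stated noise
     term. *)
  have -> : 1 - r = alpha * (mu * (2 - alpha * mu)) by rewrite /r; ring.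
  move: (r ^+ k) => q; field.
  by rewrite !gt_eqF // subr_gt0; lra.
have mx k : measurable_fun setT (x k : T -> borelcV R (N * d)).
  by apply: measurable_dsg.
split.
- move=> k; have [_] := bound k.
  by rewrite unlock; under [X in (_ -> X <= _)%E]eq_integral do rewrite enorm_sqr.
- move=> sigma0.
  have N0 : (0 : R) < N%:R by rewrite ltr0n ltnW.
  have s0 : 0 < sigma ^+ 2 * N%:R by rewrite mulr_gt0 ?exprn_gt0.
  pose l := alpha * sigma ^+ 2 * N%:R / (mu * (2 - alpha * mu)).
  have hl : (limn_esup (fun k => vvar P (x k)) <= l%:E)%E.
    apply: (@limn_esup_le_lim _ _ B) => [k|].
      have [i h] := bound k; apply: le_trans h; apply: vvar_le i => j.
      exact: (measurableT_comp (borelcV_coord j) (mx k)).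
    have cr : (fun k => r ^+ k) @ \oo --> (0 : R).
      by apply: cvg_expr; rewrite ger0_norm.
    (* The bound interpolates between its initial value [D] and its limit [l] with geometric weight
       r^k. *)
    have -> : B = (fun k => l + (D - l) * r ^+ k).
      by apply/funext => k; rewrite /B exprM -/r /l; ring.
    rewrite -[X in _ --> X]addr0 -(mulr0 (D - l)).
    by apply: cvgD; [exact: cvg_cst|apply: cvgMr].
  rewrite /J_infty.
  have -> : alpha / (mu * (2 - alpha * mu)) = (sigma ^+ 2 * N%:R)^-1 * l.
    rewrite /l; field.
    by rewrite !gt_eqF // subr_gt0; lra.
  by rewrite EFinM lee_wpmul2l // lee_fin invr_ge0 ltW.
- move=> _ k.
  set xs := stack (fun _ => xstar).
  have hx := xinf_xstar_le hmu hmuL hconv hlip hN he hW hlam halpha0 halpha hxinf hxstar.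
  have [i h] := bound k.
  have i2 := rintegrableZ 2 i.
  rewrite unlock; under eq_integral do rewrite enorm_sqr.
  (* The inequality |a + b|^2 <= 2 |a|^2 + 2 |b|^2 is the source of the factors 2 in the last
     bound. *)
  have le2 t : dot (x k t - xs) (x k t - xs) <=
      2 * dot (x k t - xinf) (x k t - xinf) + 2 * enorm (xinf - xs) ^+ 2.
    have -> : x k t - xs = (x k t - xinf) + (xinf - xs) by rewrite addrA subrK.
    move: (x k t - xinf) (xinf - xs) => a b; rewrite enorm_sqr.
    have := dot_ge0 (a - b); rewrite !dotE (dotC b a); lra.
  apply: (@le_trans _ _ (\int[P]_t (2 * dot (x k t - xinf) (x k t - xinf) +
      2 * enorm (xinf - xs) ^+ 2)%:E)%E).
    apply: ge0_le_integral => //.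
    + by move=> t _; rewrite lee_fin dot_ge0.
    + apply/measurable_EFinP; exact: measurable_dist.
    + exact: measurable_int (rintegrableD i2 (rintegrable_cst P (2 * enorm (xinf - xs) ^+ 2))).
    + by move=> t _; rewrite lee_fin.
  rewrite rintegralD //; last exact: rintegrable_cst.
  rewrite rintegral_cst rintegralZ //.
  apply: (@le_trans _ _ (2%:E * (B k)%:E + (2 * enorm (xinf - xs) ^+ 2)%:E)%E).
    by rewrite leeD2r // lee_wpmul2l // lee_fin.
  rewrite -EFinM -EFinD lee_fin /B -/D.
  have : 2 * enorm (xinf - xs) ^+ 2 <=
    2 * (alpha ^+ 2 * C1_of mu L f ^+ 2 * N%:R / (1 - gamma_of lam) ^+ 2).
    by rewrite ler_pM2l.
  rewrite !mulrA; lra.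
Qed.
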